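(* Let $\mathcal Z$ be a finite dimensional inner product space, let $(f_1,f_2,h)$ and $(m_1,M_1,m_2,M_2)\in\mathbb R^4$ satisfy assumptions (A1)--(A4) listed in the context, let $\phi=f_1+f_2+h$, let $\hat\rho>0$, $y_0\in\operatorname{dom}h$, and let $(\lambda,\theta)\in(0,\infty)\times(0,1)$ satisfy $\lambda M_1+\theta^2\le \tfrac12$. Set $L_i=\max\{|m_i|,|M_i|\}$, $M_2^+=\max\{M_2,0\}$ and $$\overline C_\lambda:=\frac{1+\lambda(M_2^++L_1+L_2)}{\sqrt{1+\lambda M_2^+}} .$$ The following statements hold about the static IA-ICG method (defined in the context) run with these inputs: (a) it stops (with success or failure) in $$\mathcal O_1\left(\left[\sqrt\lambda L_1+\frac{1+\theta\overline C_\lambda}{\sqrt\lambda}\right]^2\left[\frac{\phi(y_0)-\phi_*}{\hat\rho^2}\right]\right)$$ outer iterations, where $\phi_*=\inf_{u\in\mathcal Z}\phi(u)$; (b) if it stops with success, then its output pair $(\hat y,\hat v)$ satisfies $$\hat v\in\nabla f_1(\hat y)+\nabla f_2(\hat y)+\partial h(\hat y),\qquad \|\hat v\|\le\hat\rho;$$ (c) if $f_2$ is convex, then it always stops with success.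
   Context: Notation. $\overline{\mathrm{Conv}}\,\mathcal Z$ is the set of proper lower semicontinuous convex functions $\mathcal Z\to(-\infty,\infty]$; $\ell_g(u;y):=g(y)+\langle\nabla g(y),u-y\rangle$; $\partial h$ is the convex subdifferential. $\mathcal O_1(\cdot)$ means $\mathcal O(1+\cdot)$. Assumptions. (A1) $h\in\overline{\mathrm{Conv}}\,\mathcal Z$. (A2) $f_1,f_2$ are continuously differentiable and, for $i\in\{1,2\}$, $-\frac{m_i}2\|u-y\|^2\le f_i(u)-\ell_{f_i}(u;y)\le\frac{M_i}2\|u-y\|^2$ for all $u,y\in\operatorname{dom}h$. (A3) $\|\nabla f_i(u)-\nabla f_i(y)\|\le L_i\|u-y\|$ for all $u,y\in\operatorname{dom}h$, $i\in\{1,2\}$. (A4) $\phi_*:=\inf_{\mathcal Z}\phi>-\infty$. For $\psi=\psi_s+\psi_n$ and $\mu>0$, let $$\Delta_\mu(u;y,v):=\psi(y)-\psi(u)-\langle v,y-u\rangle+\tfrac\mu2\|u-y\|^2 ,\quad u\in\operatorname{dom}\psi .$$ Refinement procedure $RP(y,v)$, for $(M,\psi_s,\psi_n)$: output $(y_r,v_r)$ with $y_r=\operatorname{argmin}_{u}\{\langle\nabla\psi_s(y)-v,u\rangle+\frac M2\|u-y\|^2+\psi_n(u)\}$ and $v_r=v+M(y-y_r)+\nabla\psi_s(y_r)-\nabla\psi_s(y)$. R-ACG algorithm. Input: $(\mu,M,\psi_s,\psi_n)$ with $\mu>0$, $M\ge0$, $\psi_n\in\overline{\mathrm{Conv}}\,\mathcal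 Z$, $\psi_s$ continuously differentiable on $\mathcal Z$ with $\psi_s(u)-\ell_{\psi_s}(u;y)\le\frac M2\|u-y\|^2$ for all $u,y\in\mathcal Z$; and $(\theta,z_0)\in(0,\infty)\times\mathcal Z$. Step 0: $\psi=\psi_s+\psi_n$, $z_0^c=z_0$, $B_0=0$, $\Gamma_0\equiv0$, $j=1$. Step 1: $\xi_{j-1}=\frac{1+\mu B_{j-1}}{M-\mu}$, $b_{j-1}=\frac{\xi_{j-1}+\sqrt{\xi_{j-1}^2+4\xi_{j-1}B_{j-1}}}2$, $B_j=B_{j-1}+b_{j-1}$, $\tilde z_{j-1}=\frac{B_{j-1}}{B_j}z_{j-1}+\frac{b_{j-1}}{B_j}z^c_{j-1}$, $z_j=\operatorname{argmin}_u\{\ell_{\psi_s}(u;\tilde z_{j-1})+\psi_n(u)+\frac M2\|u-\tilde z_{j-1}\|^2\}$, $z_j^c=\frac1{1+\mu B_j}[z^c_{j-1}-b_{j-1}(M-\mu)(\tilde z_{j-1}-z_j)+\mu(B_{j-1}z^c_{j-1}+b_{j-1}z_j)]$. Step 2: $\tilde\gamma_j=\ell_{\psi_s}(\cdot;\tilde z_{j-1})+\psi_n+\frac\mu2\|\cdot-\tilde z_{j-1}\|^2$, $\gamma_j=\tilde\gamma_j(z_j)+(M-\mu)\langle\tilde z_{j-1}-z_j,\cdot-z_j\rangle+\frac\mu2\|\cdot-z_j\|^2$, $\Gamma_j=\frac{B_{j-1}}{B_j}\Gamma_{j-1}+\frac{b_{j-1}}{B_j}\gamma_j$, $r_j=\frac{z_0^c-z_j^c}{B_j}+\mu(z_j-z_j^c)$,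 $\eta_j=\max\{0,\psi(z_j)-\Gamma_j(z_j^c)-\langle r_j,z_j-z_j^c\rangle+\frac\mu2\|z_j-z_j^c\|^2\}$. Step 3: if $\frac1{1+\mu B_j}\|B_jr_j+z_j-z_0\|^2+2B_j\eta_j\le\|z_j-z_0\|^2$ go to step 4; otherwise stop with failure. Step 4: if $\|r_j\|^2+2\eta_j\le\theta^2\|z_j-z_0\|^2$ go to step 5; otherwise set $j\leftarrow j+1$ and go to step 1. Step 5: set $(y,v,\varepsilon)=(z_j,r_j,\eta_j)$ and $(y_r,v_r)=RP(y,v)$; if $\Delta_\mu(y_r;y,v)\le\varepsilon$ stop with success and output $(y,v,\varepsilon)$; otherwise stop with failure. For a point $z_0$ write $$( * )\quad \mu=1,\ M=\lambda M_2^++1,\ \psi_s=\lambda[\ell_{f_1}(\cdot;z_0)+f_2]+\tfrac12\|\cdot-z_0\|^2,\ \psi_n=\lambda h .$$ Specialized refinement $SRP(y,v,z_0)$: compute $(\hat y,v_r)=RP(y,v)$ with $(M,\psi_s,\psi_n)$ as in $( * )$, set $\hat v=\frac1\lambda(v_r+z_0-\hat y)+\nabla f_1(\hat y)-\nabla f_1(z_0)$, and output $(\hat y,\hat v)$. Static IA-ICG method. Set $k=1$. Step 1: call R-ACG with inputs $( * )$, $z_0=y_{k-1}$, and $\theta$; if it fails, stop with failure; otherwise let $(y_k,v_k,\varepsilon_k)$ be its output. Step 2: if $\Delta_1(y_{k-1};y_k,v_k)\le\varepsilon_k$ (with $\psi_s,\psi_n$ as in $( * )$, $z_0=y_{k-1}$)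 go to step 3; otherwise stop with failure. Step 3: set $(\hat y_k,\hat v_k)=SRP(y_k,v_k,y_{k-1})$; if $\|\hat v_k\|\le\hat\rho$ stop with success and output $(\hat y,\hat v)=(\hat y_k,\hat v_k)$; otherwise $k\leftarrow k+1$ and go to step 1. The iterations indexed by $k$ are the outer iterations.
   Formalization: The formal theorem assumes M_2^+ > 0, since R-ACG divides by M − μ = λM_2^+, and in (c) also assumes that the inputs ( * ) meet R-ACG's input requirement (the upper quadratic bound on ψ_s on all of Z), without which (c) fails because iterates may leave dom h. *)

(* Defs.v *)
From HB Require Import structures.
From mathcomp Require Import all_boot all_order all_algebra.
From mathcomp Require Import all_classical all_reals all_analysis.

Set Implicit Arguments.
Unset Strict Implicit.
Unset Printing Implicit Defensive.

Import Order.TTheory GRing.Theory Num.Theory.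
Import numFieldNormedType.Exports.

#[global] Open Scope classical_set_scope.
#[global] Open Scope ring_scope.

Definition finite_dimensional (R : realType) (Z : normedModType R) : Prop :=
  exists (n : nat) (e : 'I_n -> Z),
    forall x : Z, exists c : 'I_n -> R, x = \sum_(i < n) c i *: e i.

Section ConvexAnalysis.
Context {R : realType} {Z : normedModType R} (ip : {dot Z for (@idfun R)}).
Implicit Types (f : Z -> R) (h : Z -> \bar R) (u x y : Z).

(* The norm of [Z] is a datum of the normed module; this says that it is the
   one induced by the inner product. *)
Definition norm_induced_by : Prop := forall u, `|u| ^+ 2 = ip u u.

Definition edom h : set Z := [set u | (h u < +oo)%E].

(* With the convention [0 * +oo = 0] of [\bar R], the endpoints [t = 0, 1]
   are harmless; [-oo] is excluded, so no sum is of the form [+oo - oo]. *)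
Definition econvex h : Prop :=
  forall x y (t : R), 0 <= t <= 1 ->
    (h (t *: x + (1 - t) *: y)%R <= t%:E * h x + (1 - t)%:E * h y)%E.

Definition Conv_bar h : Prop :=
  [/\ forall u, h u != -oo%E, edom h !=set0, lower_semicontinuous h
    & econvex h].

Definition subdiff h x : set Z :=
  [set v | forall u, (h x + (ip v (u - x))%:E <= h u)%E].

(* Riesz representative of the differential; meaningful only where [f] is
   differentiable. *)
Definition grad f x : Z :=
  xget 0 [set g | forall u, 'd f x u = ip g u].

Definition cont_diff f : Prop :=
  (forall x, differentiable f x) /\ continuous (grad f).

Definition lin f u y : R := f y + ip (grad f y) (u - y).

Definition argmin (F : Z -> \bar R) : Z :=
  xget 0 [set u | forall w, (F u <= F w)%E].

End ConvexAnalysis.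

Section RACG.
Context {R : realType} {Z : normedModType R} (ip : {dot Z for (@idfun R)}).
Variables (mu M : R) (psi_s : Z -> R) (psi_n : Z -> \bar R).

Definition psi (u : Z) : \bar R := ((psi_s u)%:E + psi_n u)%E.

Definition Delta (u y v : Z) : \bar R :=
  (psi y - psi u - (ip v (y - u))%:E + (mu / 2 * `|u - y| ^+ 2)%:E)%E.

Definition RP (y v : Z) : Z * Z :=
  let yr := argmin (fun u => (ip (grad ip psi_s y - v) u
                              + M / 2 * `|u - y| ^+ 2)%:E + psi_n u)%E in
  (yr, v + M *: (y - yr) + grad ip psi_s yr - grad ip psi_s y).

Definition racg_input (theta : R) : Prop :=
  [/\ 0 < mu /\ 0 <= M, Conv_bar psi_n, cont_diff ip psi_s,
      forall u y, psi_s u - lin ip psi_s u y <= M / 2 * `|u - y| ^+ 2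
    & 0 < theta].

Variables (theta : R) (z0 : Z).

Record racg_state := RacgState {
  rB : R;
  rz : Z;
  rzc : Z;
  rGamma : Z -> R
}.

Definition racg_init : racg_state := RacgState 0 z0 z0 (fun=> 0).

(* [psi_n] is finite at [z], hence so is [gt z], and [fine] is faithful. *)
Definition racg_step (s : racg_state) : racg_state :=
  let xi := (1 + mu * rB s) / (M - mu) in
  let b := (xi + Num.sqrt (xi ^+ 2 + 4 * xi * rB s)) / 2 in
  let B := rB s + b in
  let zt := (rB s / B) *: rz s + (b / B) *: rzc s in
  let z := argmin (fun u => (lin ip psi_s u zt)%:E + psi_n u
                            + (M / 2 * `|u - zt| ^+ 2)%:E)%E in
  let zc := (1 + mu * B)^-1 *:
    (rzc s - (b * (M - mu)) *: (zt - z) + mu *: (rB s *: rzc s + b *: z)) in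
  let gt := fun u => ((lin ip psi_s u zt)%:E + psi_n u
                      + (mu / 2 * `|u - zt| ^+ 2)%:E)%E in
  let gamma := fun u => fine (gt z) + (M - mu) * ip (zt - z) (u - z)
                        + mu / 2 * `|u - z| ^+ 2 in
  RacgState B z zc (fun u => rB s / B * rGamma s u + b / B * gamma u).

Definition racg_iter (j : nat) : racg_state := iter j racg_step racg_init.

Definition racg_r (s : racg_state) : Z :=
  (rB s)^-1 *: (z0 - rzc s) + mu *: (rz s - rzc s).

Definition racg_eta (s : racg_state) : R :=
  Num.max 0 (fine (psi (rz s)) - rGamma s (rzc s)
             - ip (racg_r s) (rz s - rzc s)
             + mu / 2 * `|rz s - rzc s| ^+ 2).

Definition racg_test3 (s : racg_state) : bool :=
  (1 + mu * rB s)^-1 * `|rB s *: racg_r s + rz s - z0| ^+ 2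
    + 2 * rB s * racg_eta s <= `|rz s - z0| ^+ 2.

Definition racg_test4 (s : racg_state) : bool :=
  `|racg_r s| ^+ 2 + 2 * racg_eta s <= theta ^+ 2 * `|rz s - z0| ^+ 2.

Definition racg_test5 (s : racg_state) : bool :=
  (Delta (RP (rz s) (racg_r s)).1 (rz s) (racg_r s) <= (racg_eta s)%:E)%E.

(* [racg_from j o]: entered at iteration [j], the loop halts with outcome [o],
   where [None] is failure and [Some (y, v, eps)] is success. *)
Inductive racg_from (j : nat) : option (Z * Z * R) -> Prop :=
| racg_fail3 :
    ~~ racg_test3 (racg_iter j) -> racg_from j None
| racg_next o :
    racg_test3 (racg_iter j) -> ~~ racg_test4 (racg_iter j) ->
    racg_from j.+1 o -> racg_from j o
| racg_fail5 :
    racg_test3 (racg_iter j) -> racg_test4 (racg_iter j) ->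
    ~~ racg_test5 (racg_iter j) -> racg_from j None
| racg_success :
    racg_test3 (racg_iter j) -> racg_test4 (racg_iter j) ->
    racg_test5 (racg_iter j) ->
    racg_from j (Some (rz (racg_iter j), racg_r (racg_iter j),
                       racg_eta (racg_iter j))).

Definition racg_halts := racg_from 1.

End RACG.

Section IAICG.
Context {R : realType} {Z : normedModType R} (ip : {dot Z for (@idfun R)}).
Variables (f1 f2 : Z -> R) (h : Z -> \bar R) (M2 lambda theta rho : R).

Definition ia_M : R := lambda * Num.max M2 0 + 1.

Definition ia_psi_s (z0 u : Z) : R :=
  lambda * (lin ip f1 u z0 + f2 u) + 1 / 2 * `|u - z0| ^+ 2.

Definition ia_psi_n (u : Z) : \bar R := (lambda%:E * h u)%E.

Definition SRP (y v z0 : Z) : Z * Z :=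
  let: (yh, vr) := RP ip ia_M (ia_psi_s z0) ia_psi_n y v in
  (yh, lambda^-1 *: (vr + z0 - yh) + grad ip f1 yh - grad ip f1 z0).

Definition ia_racg (z0 : Z) : option (Z * Z * R) -> Prop :=
  racg_halts ip 1 ia_M (ia_psi_s z0) ia_psi_n theta z0.

Definition ia_racg_input (z0 : Z) : Prop :=
  racg_input ip 1 ia_M (ia_psi_s z0) ia_psi_n theta.

Definition ia_Delta (z0 : Z) : Z -> Z -> Z -> \bar R :=
  Delta ip 1 (ia_psi_s z0) ia_psi_n.

(* [iaicg_from k y K o]: outer iteration [k], entered with [y_{k-1} = y], leads
   to the method halting during outer iteration [K] with outcome [o], where
   [None] is failure and [Some (yh, vh)] is success. *)
Inductive iaicg_from (k : nat) (y : Z) : nat -> option (Z * Z) -> Prop :=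
| iaicg_fail1 :
    ia_racg y None -> iaicg_from k y k None
| iaicg_fail2 yk vk epsk :
    ia_racg y (Some (yk, vk, epsk)) ->
    ~~ (ia_Delta y y yk vk <= epsk%:E)%E ->
    iaicg_from k y k None
| iaicg_success yk vk epsk :
    ia_racg y (Some (yk, vk, epsk)) ->
    (ia_Delta y y yk vk <= epsk%:E)%E ->
    `|(SRP yk vk y).2| <= rho ->
    iaicg_from k y k (Some (SRP yk vk y))
| iaicg_next yk vk epsk K o :
    ia_racg y (Some (yk, vk, epsk)) ->
    (ia_Delta y y yk vk <= epsk%:E)%E ->
    ~~ (`|(SRP yk vk y).2| <= rho) ->
    iaicg_from k.+1 yk K o ->
    iaicg_from k y K o.

Definition iaicg_halts (y0 : Z) := iaicg_from 1 y0.

End IAICG.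

Section Assumptions.
Context {R : realType} {Z : normedModType R} (ip : {dot Z for (@idfun R)}).
Variables (f : Z -> R) (h : Z -> \bar R).

Definition curvature_bounds (m M : R) : Prop :=
  forall u y, edom h u -> edom h y ->
    - (m / 2) * `|u - y| ^+ 2 <= f u - lin ip f u y <= M / 2 * `|u - y| ^+ 2.

Definition grad_lipschitz (L : R) : Prop :=
  forall u y, edom h u -> edom h y ->
    `|grad ip f u - grad ip f y| <= L * `|u - y|.

End Assumptions.

(* Main.v *)
From HB Require Import structures.
Require Import Defs.
From mathcomp Require Import all_boot all_order all_algebra.
From mathcomp Require Import all_classical all_reals all_analysis.
From mathcomp Require Import ring lra.

(* The inner loop halts whether or not it fails: its third-step test bounds
   [B r + z - z0] and [eta] in terms of [z - z0], so it implies the fourth-step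
   test once [B] is large, and [B] grows at least linearly.

   In an outer iteration the test [Delta y <= eps] and the curvature of [f1]
   give [|y_k - y|^2 <= 4 lambda (phi y - phi y_k)], while the fifth-step test
   bounds the distance from [y_k] to its refinement, and thereby [v^], by a
   multiple of [|y_k - y|].  Each unsuccessful iteration thus decreases [phi] by
   a fixed amount.  The inclusion for [v^] is the optimality condition of the
   proximal subproblem solved by the refinement.

   If [f2] is convex, [psi_s] is strongly convex, and the accelerated method
   keeps [B psi (z) <= min (B Gamma + |. - z0|^2 / 2)] with [Gamma <= psi];
   these two inequalities imply every test that could report a failure. *)

Set Implicit Arguments.
Unset Strict Implicit.
Unset Printing Implicit Defensive.

Import Order.TTheory GRing.Theory Num.Theory.
Import numFieldNormedType.Exports.

Local Open Scope ring_scope.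

(** * Inner products in finite dimension *)

Section InnerProduct.
Context {R : realType} {Z : normedModType R} (ip : {dot Z for (@idfun R)}).
Implicit Types (u v w x y g : Z) (a : R).

Lemma ipC u v : ip u v = ip v u.
Proof. by rewrite (hermC ip u v) expr0 mul1r. Qed.

Lemma ipDl u v w : ip (u + v) w = ip u w + ip v w.
Proof. exact: (linearDl ip). Qed.

Lemma ipDr u v w : ip w (u + v) = ip w u + ip w v.
Proof. exact: (linearDr ip). Qed.

Lemma ipNl u w : ip (- u) w = - ip u w.
Proof. exact: (linearNl ip). Qed.

Lemma ipNr u w : ip w (- u) = - ip w u.
Proof. exact: (linearNr ip). Qed.

Lemma ipZl a u w : ip (a *: u) w = a * ip u w.
Proof. exact: (linearZl_LR ip). Qed.

Lemma ipZr a u w : ip w (a *: u) = a * ip w u.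
Proof. exact: (linearZr_LR ip). Qed.

Lemma ip0l w : ip 0 w = 0.
Proof. exact: (linear0l ip). Qed.

Lemma ip0r w : ip w 0 = 0.
Proof. exact: (linear0r ip). Qed.

Definition ipE := (ipDl, ipDr, ipNl, ipNr, ipZl, ipZr, ip0l, ip0r).

Lemma ip_suml (I : Type) (s : seq I) (F : I -> Z) w :
  ip (\sum_(i <- s) F i) w = \sum_(i <- s) ip (F i) w.
Proof.
elim: s => [|i s IHs]; first by rewrite !big_nil ip0l.
by rewrite !big_cons ipDl IHs.
Qed.

Lemma ip_sumr (I : Type) (s : seq I) (F : I -> Z) w :
  ip w (\sum_(i <- s) F i) = \sum_(i <- s) ip w (F i).
Proof. by rewrite ipC ip_suml; apply: eq_bigr => i _; rewrite ipC. Qed.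

Lemma ip_eq0 u : (ip u u == 0) = (u == 0).
Proof.
have [->|u0] := eqVneq u 0; first by rewrite ip0l eqxx.
by apply/negbTE; rewrite gt_eqF//; exact: neq0_dnorm_gt0.
Qed.

Lemma ip_inj g g' : (forall u, ip g u = ip g' u) -> g = g'.
Proof.
move=> gg'; apply/eqP; rewrite -subr_eq0 -ip_eq0.
by rewrite ipDl ipNl gg' subrr.
Qed.

Hypothesis ipN : norm_induced_by ip.

(** The norm is given first and satisfies the triangle inequality, so Cauchy-Schwarz is read off by
    squaring [|u + v| <= |u| + |v|] and expanding. *)
Lemma cauchy_schwarz u v : ip u v <= `|u| * `|v|.
Proof.
have uv : `|u + v| ^+ 2 <= (`|u| + `|v|) ^+ 2.
  by rewrite ler_pXn2r ?nnegrE ?addr_ge0// ler_normD.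
have := uv; rewrite ipN sqrrD !ipN !ipE (ipC v u).
lra.
Qed.

Lemma normr_cauchy_schwarz u v : `|ip u v| <= `|u| * `|v|.
Proof.
rewrite ler_norml cauchy_schwarz andbT lerNl -ipNl.
by rewrite (le_trans (cauchy_schwarz _ _))// normrN.
Qed.

End InnerProduct.

(** * Orthonormal expansion, completeness and gradients *)

Section FiniteDimension.
Context {R : realType} {Z : normedModType R} (ip : {dot Z for (@idfun R)}).
Implicit Types (u v w x y g : Z) (s : seq Z).

(* For an orthonormal [s], this is the orthogonal projection on its span; only
   [proj s v = v] for [v] in [s] is ever needed, not orthonormality. *)
Definition proj s x : Z := \sum_(v <- s) ip x v *: v.

Lemma projD s x y : proj s (x + y) = proj s x + proj s y.
Proof. by rewrite -big_split; apply: eq_bigr => v _; rewrite ipDl scalerDl. Qed.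

Lemma projZ s (a : R) x : proj s (a *: x) = a *: proj s x.
Proof.
by rewrite /proj scaler_sumr; apply: eq_bigr => v _; rewrite ipZl scalerA.
Qed.

Lemma proj0 s : proj s 0 = 0.
Proof. by rewrite /proj big1// => v _; rewrite ip0l scale0r. Qed.

Lemma proj_sum s (n : nat) (F : 'I_n -> Z) :
  proj s (\sum_(i < n) F i) = \sum_(i < n) proj s (F i).
Proof.
by apply: (big_morph (proj s) (projD s) (proj0 s)).
Qed.

Lemma proj_adjoint s x y : ip (proj s x) y = ip x (proj s y).
Proof.
rewrite ip_suml ip_sumr; apply: eq_bigr => v _.
by rewrite ipZl ipZr (ipC ip v y) mulrC.
Qed.

(** Induction on [es]. The residual [r = u - proj s u] is orthogonal to every vector fixed by
    [proj s], so adjoining the normalised [r] keeps those vectors fixed and also fixes [u]; if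
    [r = 0], then [s] already fixes [u]. *)
Lemma gram_schmidt (es : seq Z) :
  exists s, (forall v, v \in s -> proj s v = v) /\
            (forall v, v \in es -> proj s v = v).
Proof.
elim: es => [|u es [s [ss ses]]]; first by exists [::].
pose r := u - proj s u.
have rs v : v \in s -> ip v r = 0.
  move=> vs; rewrite /r ipDr ipNr -(proj_adjoint s v u) (ss v)//.
  by rewrite subrr.
have rfix v : proj s v = v -> ip v r = 0.
  move=> <-; rewrite ip_suml big_seq big1// => w ws.
  by rewrite ipZl rs// mulr0.
have projr : proj s r = 0.
  by rewrite /proj big_seq big1// => v vs; rewrite ipC rs// scale0r.
have [r0|r0] := eqVneq r 0.
  exists s; split=> // v; rewrite inE => /predU1P[->|]; last exact: ses.
  by apply/esym/eqP; rewrite -subr_eq0; apply/eqP.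
have nr : ip r r != 0 by rewrite ip_eq0.
have nr0 : 0 < ip r r by exact: neq0_dnorm_gt0.
pose c : R := ((Num.sqrt (ip r r))^-1)%R.
have cc : c * c * ip r r = 1.
  by rewrite -expr2 exprVn sqr_sqrtr ?mulVf// ltW.
have E v : proj (c *: r :: s) v = (c * c * ip v r) *: r + proj s v.
  by rewrite /proj big_cons ipZr scalerA mulrAC.
have keep v : proj s v = v -> proj (c *: r :: s) v = v.
  by move=> vE; rewrite E vE rfix// mulr0 scale0r add0r.
exists (c *: r :: s); split => v; rewrite inE => /predU1P[->|vin].
- by rewrite E projZ projr scaler0 addr0 ipZl mulrCA cc mulr1.
- by apply: keep; exact: ss.
(* The part [proj s u] of [u] is orthogonal to [r], because [proj s] is self-adjoint and kills
   [r]. *)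
- rewrite E; have -> : ip u r = ip r r.
    rewrite {2}/r ipDl ipNl proj_adjoint projr ip0r.
    by rewrite subr0.
  by rewrite cc scale1r subrK.
- by apply: keep; exact: ses.
Qed.

Hypothesis fd : finite_dimensional Z.

Lemma exists_proj_id : exists s, forall x, proj s x = x.
Proof.
have [n [e espan]] := fd.
have [s [_ se]] := gram_schmidt [seq e i | i <- enum 'I_n].
exists s => x; have [c ->] := espan x.
rewrite proj_sum; apply: eq_bigr => i _; rewrite projZ se//.
by apply: map_f; rewrite mem_enum.
Qed.

Hypothesis ipN : norm_induced_by ip.

(** Completeness is inherited from the reals: each coordinate [ip (u_ n) v] is Cauchy by
    Cauchy-Schwarz, and [u_ n] is a finite sum of coordinates times fixed vectors. *)
Lemma cauchy_seq_cvg (u_ : nat -> Z) :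
  (forall e : R, 0 < e -> exists N, forall n, (N <= n)%N ->
     `|u_ N - u_ n| <= e) -> cvgn u_.
Proof.
move=> u_cauchy; have [s sid] := exists_proj_id.
have coord v : cvgn (fun n => ip (u_ n) v).
  apply/cauchy_cvgP/cauchy_exP => e e0.
  have c0 : 0 < `|v| + 1 by rewrite ltr_wpDl.
  have [N uN] := u_cauchy _ (divr_gt0 e0 c0).
  exists (ip (u_ N) v), N => // n /= Nn.
  rewrite /ball/= -ipNl -ipDl (le_lt_trans (normr_cauchy_schwarz ipN _ _))//.
  rewrite (le_lt_trans (ler_wpM2r (normr_ge0 v) (uN n Nn)))//.
  by rewrite mulrAC ltr_pdivrMr// ltr_pM2l// ltrDl.
have -> : u_ = (fun n => proj s (u_ n)) by apply/funext => n; rewrite sid.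
elim: s {sid} => [|v s IHs].
  by rewrite /proj; under eq_fun do rewrite big_nil; exact: is_cvg_cst.
rewrite /proj; under eq_fun do rewrite big_cons.
by apply: is_cvgD => //; apply: is_cvgZl; exact: coord.
Qed.

Lemma riesz (phi : {linear Z -> R^o}) : exists g, forall u, phi u = ip g u.
Proof.
have [s sid] := exists_proj_id; exists (\sum_(v <- s) phi v *: v) => u.
rewrite -[in LHS](sid u) linear_sum ip_suml; apply: eq_bigr => v _.
by rewrite linearZ ipZl mulrC (ipC ip v).
Qed.

Lemma ip_is_linear g : linear (ip g : Z -> R^o).
Proof. by move=> a u v; rewrite ipDr ipZr. Qed.

Definition ip_fun g : Z -> R^o := ip g.

HB.instance Definition _ g :=
  GRing.isLinear.Build R Z R^o _ (ip_fun g) (ip_is_linear g).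

Lemma continuous_ip g : continuous (ip_fun g).
Proof.
apply: bounded_linear_continuous; apply/linear_boundedP.
near=> r => x; rewrite (le_trans (normr_cauchy_schwarz ipN _ _))//.
apply: ler_wpM2r => //; near: r; apply: nbhs_pinfty_ge.
Unshelve. all: end_near. Qed.

(** The first-order expansion in epsilon form; it links the differential, from which [grad] is
    defined, to explicit estimates in both directions. *)
Definition is_grad (f : Z -> R) x g : Prop :=
  forall e : R, 0 < e ->
    \forall w \near (0 : Z), `|f (x + w) - f x - ip g w| <= e * `|w|.

Lemma differentiable_is_grad (f : Z -> R) x :
  differentiable f x -> is_grad f x (grad ip f x).
Proof.
move=> df; rewrite /grad; case: xgetP => [_ -> /= dfE|nodf]; last first.
  (* The default value of [xget] cannot occur: Riesz representation makes the set of candidates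
     nonempty. *)
  by have [g dfg] := riesz ('d f x : {linear Z -> R^o}); case: (nodf g).
move=> e e0; have /eqaddoP/(_ _ e0) := diff_locally df.
apply: filterS => w.
have <- : f (w + x) - (f x + 'd f x w) =
    f (x + w) - f x - ip (xget 0 [set g | forall u, 'd f x u = ip g u]) w.
  by rewrite dfE opprD addrA [w + x]addrC.
by [].
Qed.

Lemma grad_unique (f : Z -> R) x g : is_grad f x g -> grad ip f x = g.
Proof.
move=> fg; have dfE : 'd f x = ip_fun g :> (Z -> R).
  apply: (diff_unique (f := f : Z -> R^o)); first exact: continuous_ip.
  apply/eqaddoP => e e0; have := fg e e0.
  apply: filterS => w.
  have -> : f (x + w) - f x - ip g w = f (w + x) - (f x + ip_fun g w).
    by rewrite opprD addrA [w + x]addrC.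
  by [].
rewrite /grad; case: xgetP => [g' _ /= dfg'|/(_ g)]; last first.
  by case=> u; rewrite /= dfE.
by apply: (@ip_inj _ _ ip) => u; rewrite -dfg' dfE.
Qed.

End FiniteDimension.

(** * Convex functions and strongly convex quadratic perturbations *)

Section ConvexFunctions.
Context {R : realType} {Z : normedModType R} (ip : {dot Z for (@idfun R)}).
Implicit Types (u v w x y : Z) (n : Z -> \bar R).

Lemma Conv_bar_fineK n u : Conv_bar n -> edom n u -> (fine (n u))%:E = n u.
Proof. by case=> nN _ _ _ nu; rewrite fineK// fin_numE nN/= lt_eqF. Qed.

Lemma Conv_bar_notin n u : ~ edom n u -> n u = +oo%E.
Proof. by rewrite /edom/= => /negP; rewrite -leNgt leye_eq => /eqP. Qed.

Lemma Conv_bar_convex n x y (t : R) : Conv_bar n -> edom n x -> edom n y ->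
  0 <= t <= 1 -> edom n (t *: x + (1 - t) *: y) /\
  fine (n (t *: x + (1 - t) *: y)) <= t * fine (n x) + (1 - t) * fine (n y).
Proof.
move=> nC nx ny t01; have [_ _ _ /(_ x y t t01)] := nC.
rewrite -(Conv_bar_fineK nC nx) -(Conv_bar_fineK nC ny) -!EFinM -EFinD => le.
have nxy : edom n (t *: x + (1 - t) *: y).
  by rewrite /edom/= (le_lt_trans le)// ltry.
by split=> //; rewrite -lee_fin (Conv_bar_fineK nC nxy).
Qed.

Lemma mule_neqNy (t : R) (x : \bar R) :
  0 <= t -> x != -oo%E -> (t%:E * x != -oo)%E.
Proof.
rewrite le_eqVlt => /predU1P[<-|t0]; first by rewrite mul0e.
by case: x => [r| |]// _; rewrite gt0_muley ?lte_fin.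
Qed.

Lemma Conv_bar_scale (lambda : R) n : 0 < lambda -> Conv_bar n ->
  Conv_bar (fun u => lambda%:E * n u)%E.
Proof.
move=> l0 nC; have [nN [x0 nx0] lsc cvx] := nC; split.
- by move=> u; rewrite mule_neqNy// ltW.
- by exists x0; rewrite /edom/= -(Conv_bar_fineK nC nx0) -EFinM ltry.
- move=> x a; rewrite muleC -lte_pdivrMr// -EFinM => /lsc[V Vx nV].
  by exists V => // y /nV; rewrite EFinM lte_pdivrMr// muleC.
- move=> x y t t01; have := cvx x y t t01.
  rewrite -(@lee_pmul2l _ lambda%:E)//.
  move/le_trans; apply; rewrite muleDr//; last first.
    have [t0 t1] := andP t01.
    by apply: ltninfty_adde_def; rewrite inE ltNye mule_neqNy// subr_ge0.
  rewrite !muleA [(lambda%:E * t%:E)%E]muleC.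
  by rewrite [(lambda%:E * (1 - t)%:E)%E]muleC.
Qed.

Lemma linear_perturbation_ge0 (A B : R) :
  (forall t, 0 < t < 1 -> 0 <= A + t * B) -> 0 <= A.
Proof.
move=> AB; rewrite leNgt; apply/negP => A0.
have B0 := normr_ge0 B; have D0 : 0 < `|B| - A + 1 by lra.
(* If [A < 0], this [t] satisfies [t * |B| < - A], so [A + t * B] would be negative; it replaces the
   limit [t -> 0]. *)
have t01 : 0 < - A / (`|B| - A + 1) < 1.
  by rewrite divr_gt0 ?oppr_gt0//= ltr_pdivrMr//; lra.
have := AB _ t01; rewrite leNgt => /negP; apply.
have tB : - A / (`|B| - A + 1) * B <= - A / (`|B| - A + 1) * `|B|.
  by rewrite ler_wpM2l ?ler_norm//; case/andP: t01 => /ltW.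
have : - A / (`|B| - A + 1) * `|B| < - A.
  by rewrite mulrAC ltr_pdivrMr//; nra.
lra.
Qed.

Hypothesis ipN : norm_induced_by ip.

Lemma normB_convex x y p (t : R) :
  `|t *: x + (1 - t) *: y - p| ^+ 2 =
  t * `|x - p| ^+ 2 + (1 - t) * `|y - p| ^+ 2 - t * (1 - t) * `|x - y| ^+ 2.
Proof.
by rewrite !ipN !(ipE ip) (ipC ip y x) (ipC ip p x) (ipC ip p y); ring.
Qed.

(** Comparing [x] with the points [t w + (1 - t) x] and dividing by [t] leaves the claimed
    inequality up to an error [t * (c / 2) * |w - x|^2], which vanishes with [t]. The conclusion
    says that [c (p - x) - a] is a subgradient of [n] at [x]. *)
Lemma argmin_variational n (k : R) a (c : R) p x : Conv_bar n ->
  (forall w, ((k + ip a x + c / 2 * `|x - p| ^+ 2)%:E + n x <=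
              (k + ip a w + c / 2 * `|w - p| ^+ 2)%:E + n w)%E) ->
  edom n x /\ forall w, edom n w ->
    fine (n x) + ip (c *: (p - x) - a) (w - x) <= fine (n w).
Proof.
move=> nC xmin; have [nN [x0 nx0] _ _] := nC.
have nx : edom n x.
  apply: contrapT => /Conv_bar_notin nx; have := xmin x0.
  by rewrite nx addey// -(Conv_bar_fineK nC nx0) -EFinD leye_eq.
split=> // w nw; rewrite -subr_ge0.
apply: (@linear_perturbation_ge0 _ (c / 2 * `|w - x| ^+ 2)) => t t01.
have t01' : 0 <= t <= 1 by lra.
have [nt let_] := Conv_bar_convex nC nw nx t01'.
have := xmin (t *: w + (1 - t) *: x).
rewrite -(Conv_bar_fineK nC nx) -(Conv_bar_fineK nC nt) -!EFinD lee_fin.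
rewrite normB_convex => xm.
have := normB_convex w x p t.
have -> : ip (c *: (p - x) - a) (w - x) =
    c / 2 * (`|w - p| ^+ 2 - `|x - p| ^+ 2 - `|w - x| ^+ 2) * (-1)
    - ip a w + ip a x.
  by rewrite !ipN !(ipE ip) (ipC ip x w) (ipC ip p w) (ipC ip p x); field.
rewrite (ipE ip) in xm; move=> _.
rewrite !(ipE ip) in xm.
rewrite -(pmulr_rge0 _ (_ : 0 < t)); last by lra.
nra.
Qed.

(* Lower semicontinuity bounds [n] below near one point of its domain, and
   convexity spreads that bound; no supporting affine function is needed. *)
Lemma Conv_bar_cone_bound n x0 : Conv_bar n -> edom n x0 ->
  exists2 b : R, 0 <= b & forall u, edom n u ->
    fine (n x0) - 1 - b * `|u - x0| <= fine (n u).
Proof.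
move=> nC nx0; have [nN _ lsc _] := nC.
have /lsc[V] : ((fine (n x0) - 1)%:E < n x0)%E.
  by rewrite -[ltRHS](Conv_bar_fineK nC nx0) lte_fin ltrBlDr ltrDl.
move=> /nbhs_ballP[d /= d0 dV] nV.
exists d^-1; first by rewrite invr_ge0 ltW.
move=> u nu; have u0 := normr_ge0 (u - x0).
have D0 : 0 < `|u - x0| + d by lra.
pose t := d / (`|u - x0| + d).
have t0 : 0 < t by rewrite divr_gt0.
have t1 : t <= 1 by rewrite ler_pdivrMr// mul1r lerDr.
have t01 : 0 <= t <= 1 by rewrite t1 ltW.
have [nt nt_le] := Conv_bar_convex nC nu nx0 t01.
have : ball x0 d (t *: u + (1 - t) *: x0).
  rewrite -ball_normE /ball_/= -normrN opprB.
  have -> : t *: u + (1 - t) *: x0 - x0 = t *: (u - x0).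
    by rewrite scalerBl scale1r scalerBr addrA addrAC addrK.
  rewrite normrZ gtr0_norm// /t mulrAC ltr_pdivrMr//.
  by rewrite mulrDr; have := mulr_gt0 d0 d0; lra.
move=> /dV/nV; rewrite -(Conv_bar_fineK nC nt) lte_fin => lb.
have : t * (fine (n x0) - fine (n u)) <= 1 by lra.
rewrite -ler_pdivlMl// mulr1 {1}/t invf_div mulrDl divff ?gt_eqF//.
by rewrite [d^-1 * _]mulrC; lra.
Qed.

Hypothesis fd : finite_dimensional Z.

(** Direct method: the objective is bounded below, strong convexity makes a minimizing sequence
    Cauchy, and lower semicontinuity of [n] shows that its limit is a minimizer. *)
Lemma quad_argmin_exists n (k : R) a (c : R) p : Conv_bar n -> 0 < c ->
  exists x, forall w, ((k + ip a x + c / 2 * `|x - p| ^+ 2)%:E + n x <=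
                       (k + ip a w + c / 2 * `|w - p| ^+ 2)%:E + n w)%E.
Proof.
move=> nC c0; have [nN [x0 nx0] lsc _] := nC.
pose q w := k + ip a w + c / 2 * `|w - p| ^+ 2.
pose G w := q w + fine (n w).
have [b b0 nlb] := Conv_bar_cone_bound nC nx0.
have Glb : exists L : R, forall w, edom n w -> L <= G w.
  pose B := b + `|a|.
  (* The cone bound on [n] and the linear term lose at most slope [B] in [|w - p|]; completing the
     square against [c / 2 * |w - p|^2] costs [B^2 / (2 c)]. *)
  exists (k + ip a p + fine (n x0) - 1 - b * `|p - x0| - B ^+ 2 / (2 * c)).
  move=> w /nlb wlb.
  have tri : `|w - x0| <= `|w - p| + `|p - x0|.
    by rewrite (le_trans _ (ler_normD _ _))// addrA subrK.
  have cs : - (`|a| * `|w - p|) <= ip a w - ip a p.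
    have := normr_cauchy_schwarz ipN a (w - p).
    by rewrite !(ipE ip) ler_norml => /andP[].
  have btri := ler_wpM2l b0 tri.
  have sq : B * `|w - p| <= c / 2 * `|w - p| ^+ 2 + B ^+ 2 / (2 * c).
    rewrite -subr_ge0.
    have -> : c / 2 * `|w - p| ^+ 2 + B ^+ 2 / (2 * c) - B * `|w - p| =
              (c * `|w - p| - B) ^+ 2 / (2 * c) by field; rewrite gt_eqF.
    by rewrite divr_ge0 ?sqr_ge0// mulr_ge0// ltW.
  have BE : B * `|w - p| = b * `|w - p| + `|a| * `|w - p| by rewrite mulrDl.
  by rewrite /G /q; clearbody B; lra.
have [L GL] := Glb.
pose E : set R := G @` edom n.
have E0 : has_inf E.
  by split; [exists (G x0), x0|exists L => _ [w nw <-]; exact: GL].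
have [m mE] : exists m : R, m = inf E by exists (inf E).
have Gm w : edom n w -> m <= G w.
  by move=> nw; rewrite mE; apply: ge_inf; [exact: E0.2|exists w].
have /choice[u_ u_min] : forall i : nat, exists w,
    edom n w /\ G w < m + (i.+1%:R)^-1.
  move=> i; have i0 : 0 < (i.+1%:R : R)^-1 by rewrite invr_gt0.
  by have [_ [w nw <-]] := inf_adherent i0 E0; rewrite -mE; exists w.
have half : 0 <= (2^-1 : R) <= 1 by lra.
(* The midpoint has value at least [m], and [normB_convex] at [t = 1/2] supplies the quadratic
   gain. *)
have mid v w : edom n v -> edom n w ->
    c / 4 * `|v - w| ^+ 2 <= G v + G w - 2 * m.
  move=> nv nw; have [nvw le] := Conv_bar_convex nC nv nw half.
  have := Gm _ nvw; rewrite /G /q normB_convex !(ipE ip); lra.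
have u_cvg : cvgn u_.
  apply: (cauchy_seq_cvg fd ipN) => e e0.
  (* Past [N] both values exceed [m] by at most [c e^2 / 8], so [mid] gives
     [c / 4 * |u_ N - u_ i|^2 <= c e^2 / 4]. *)
  have ce : 0 < c * e ^+ 2 / 8 by rewrite divr_gt0// mulr_gt0// exprn_gt0.
  have [N] := ltr_add_invr (x := c * e ^+ 2 / 8) (y := 0) ce.
  rewrite add0r => NE; exists N => i Ni.
  have [nN' GN] := u_min N; have [ni Gi] := u_min i.
  have iN : (i.+1%:R : R)^-1 <= N.+1%:R^-1 by rewrite lef_pV2 ?posrE// ler_nat.
  have mi := mid _ _ nN' ni.
  rewrite -(@ler_pXn2r _ 2)// ?nnegrE ?normr_ge0// ?(ltW e0)//.
  rewrite -(ler_pM2l (_ : 0 < c / 4)); last by lra.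
  apply: (le_trans mi); rewrite -subr_ge0.
  set rN := N.+1%:R^-1 in NE iN GN; set ri := i.+1%:R^-1 in iN Gi.
  by clearbody rN ri G; lra.
pose l := lim (u_ @ \oo).
have ul : u_ @ \oo --> l by [].
exists l => w; rewrite -!/(q _) leNgt; apply/negP => wl.
have nw : edom n w.
  apply: contrapT => /Conv_bar_notin nw; move: wl.
  by rewrite nw addey// ltNge leey.
have ml : ((m - q l)%:E < n l)%E.
  rewrite EFinB lteBlDl//; apply: le_lt_trans wl.
  by rewrite -(Conv_bar_fineK nC nw) -EFinD lee_fin Gm.
(* The slack [2 d] is split: lower semicontinuity keeps [n (u_ i)] above [m - q l + 2 d], continuity
   of [q] loses at most [d], so [G (u_ i) > m + d] eventually, against the choice of [u_]. If [n l]
   is infinite, any [d] will do. *)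
have [d d0 md] : exists2 d, 0 < d & ((m - q l + 2 * d)%:E < n l)%E.
  move: ml; case: (n l) (nN l) => [r| |]// _; last first.
    by move=> _; exists 1 => //; rewrite ltry.
  rewrite lte_fin => mr; exists ((r - (m - q l)) / 4); first lra.
  by rewrite lte_fin; lra.
have [V Vl nV] := lsc _ _ md.
have qc : q \o u_ @ \oo --> q l.
  rewrite /q; apply: cvgD; first apply: cvgD; first exact: cvg_cst.
    exact: (cvg_comp _ (ip_fun ip a) ul (continuous_ip ipN (g := a) (x := l))).
  have up : `|u_ i - p| @[i --> \oo] --> `|l - p|.
    by apply: cvg_norm; apply: cvgB => //; exact: cvg_cst.
  by apply: cvgMr; exact: (cvgM up up).
have [N NE] := ltr_add_invr (x := d) (y := 0) d0; rewrite add0r in NE.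
have : \forall i \near \oo, False.
  near=> i.
  have [ni Gi] := u_min i.
  have iN : (i.+1%:R : R)^-1 <= N.+1%:R^-1.
    by rewrite lef_pV2 ?posrE// ler_nat; near: i; exists N.
  have : ((m - q l + 2 * d)%:E < n (u_ i))%E by apply: nV; near: i; apply: ul.
  rewrite -(Conv_bar_fineK nC ni) lte_fin => nlow.
  have : `|q l - q (u_ i)| < d.
    by near: i; move/cvgrPdist_lt : qc; apply.
  rewrite ltr_norml => /andP[_ qlow].
  have : m + d < m + i.+1%:R^-1.
    rewrite (le_lt_trans _ Gi)// /G.
    by move: (q l) (q (u_ i)) (fine _) nlow qlow => *; lra.
  by rewrite ltrD2l ltNge (le_trans iN)// ltW.
by case=> i _ /(_ i (leqnn i)).
Unshelve. all: end_near. Qed.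

(** Existence of a minimizer ensures that [argmin] is a genuine one and not its default value
    [0]. *)
Lemma argmin_quadP n (k : R) a (c : R) p F : Conv_bar n -> 0 < c ->
  (forall u, F u = ((k + ip a u + c / 2 * `|u - p| ^+ 2)%:E + n u)%E) ->
  edom n (argmin F) /\ forall w, edom n w ->
    fine (n (argmin F)) + ip (c *: (p - argmin F) - a) (w - argmin F)
    <= fine (n w).
Proof.
move=> nC c0 FE; apply: (argmin_variational (k := k) nC).
rewrite /argmin; case: xgetP => [x _ /= xmin w|noarg]; first by rewrite -!FE.
have [x xmin] := quad_argmin_exists k a p nC c0.
by case: (noarg x) => w /=; rewrite !FE.
Qed.

End ConvexFunctions.

(** * Gradients of convex functions and of the prox-linear model *)

Section Gradients.
Context {R : realType} {Z : normedModType R} (ip : {dot Z for (@idfun R)}).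
Implicit Types (f : Z -> R) (u v w x y : Z).

Lemma convex_functionT f u y (t : R) : convex_function setT f -> 0 <= t <= 1 ->
  f (t *: u + (1 - t) *: y) <= t * f u + (1 - t) * f y.
Proof.
move=> fC /andP[t0 t1]; have := fC (Itv01 t0 t1) u y.
by rewrite !in_setT => /(_ isT isT).
Qed.

(** At [y + t (u - y)], convexity bounds [f] from above and the expansion at [y] bounds it from
    below up to [t e]; dividing by [t] gives the claim up to [e]. *)
Lemma convex_is_grad f u y g : convex_function setT f ->
  is_grad ip f y g -> f y + ip g (u - y) <= f u.
Proof.
move=> fC fg; rewrite -subr_ge0; apply/ler_addgt0Pl => e e0.
have [->|uy] := eqVneq u y.
  by rewrite subrr ip0r addr0 subrr addr0 ltW.
have uy0 : 0 < `|u - y| by rewrite normr_gt0 subr_eq0.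
have /nbhs_ballP[d /= d0 dg] := fg _ (divr_gt0 e0 uy0).
have D0 : 0 < `|u - y| + d by lra.
(* This weight makes [|t (u - y)| < d], inside the ball where the expansion is accurate. *)
pose t := d / (`|u - y| + d).
have t0 : 0 < t by rewrite divr_gt0.
have t1 : t <= 1 by rewrite ler_pdivrMr// mul1r lerDr ltW.
have tE : t *: u + (1 - t) *: y = y + t *: (u - y).
  by rewrite scalerBl scale1r scalerBr addrCA.
have t01 : 0 <= t <= 1 by rewrite t1 ltW.
have := convex_functionT u y fC t01; rewrite tE => ft.
have : ball (0 : Z) d (t *: (u - y)).
  rewrite -ball_normE /ball_/= sub0r normrN normrZ gtr0_norm// /t.
  by rewrite mulrAC ltr_pdivrMr// mulrDr; have := mulr_gt0 d0 d0; lra.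
move=> /dg /=; rewrite normrZ gtr0_norm// ipZr mulrCA divfK ?gt_eqF//.
rewrite ler_norml => /andP[low _].
rewrite -(pmulr_rge0 _ t0); nra.
Qed.

Hypothesis ipN : norm_induced_by ip.
Hypothesis fd : finite_dimensional Z.

Lemma grad_ia_psi_s f1 f2 (lambda : R) z0 x : 0 < lambda ->
  differentiable f2 x ->
  grad ip (ia_psi_s ip f1 f2 lambda z0) x =
  lambda *: (grad ip f1 z0 + grad ip f2 x) + (x - z0).
Proof.
move=> l0 /(differentiable_is_grad ip fd) df2.
apply: (grad_unique ipN) => e e0.
(* Half of the tolerance goes to the remainder of [f2], scaled by [lambda], and half to the
   quadratic remainder [|w|^2 / 2]. *)
have e2 : 0 < e / (2 * lambda) by rewrite divr_gt0// mulr_gt0.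
near=> w.
have -> : ia_psi_s ip f1 f2 lambda z0 (x + w) - ia_psi_s ip f1 f2 lambda z0 x
    - ip (lambda *: (grad ip f1 z0 + grad ip f2 x) + (x - z0)) w =
    lambda * (f2 (x + w) - f2 x - ip (grad ip f2 x) w) + `|w| * (`|w| / 2).
  have -> : `|w| * (`|w| / 2) = `|w| ^+ 2 / 2 by rewrite mulrA.
  rewrite /ia_psi_s /lin !ipN !(ipE ip) (ipC ip x w) (ipC ip z0 w).
  by rewrite (ipC ip z0 x); field.
have w1 : `|f2 (x + w) - f2 x - ip (grad ip f2 x) w| <=
    e / (2 * lambda) * `|w| by near: w; exact: df2.
have w2 : `|w| <= e.
  near: w; apply/nbhs_ballP; exists e => //= w.
  by rewrite -ball_normE /ball_/= sub0r normrN => /ltW.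
rewrite (le_trans (ler_normD _ _))// normrM gtr0_norm//.
rewrite [X in _ + X]ger0_norm ?mulr_ge0 ?divr_ge0//.
have := ler_wpM2l (ltW l0) w1; have := ler_wpM2l (normr_ge0 w) w2.
have -> : lambda * (e / (2 * lambda) * `|w|) = e * `|w| / 2.
  by field; rewrite gt_eqF.
lra.
Unshelve. all: end_near. Qed.

End Gradients.

(** * The R-ACG method *)

Section RACGTheory.
Context {R : realType} {Z : normedModType R} (ip : {dot Z for (@idfun R)}).
Variables (mu M : R) (psi_s : Z -> R) (psi_n : Z -> \bar R).
Variables (theta : R) (z0 : Z).
Implicit Types (u v w x y : Z) (s : racg_state (R := R) (Z := Z)).

Local Notation step := (racg_step ip mu M psi_s psi_n).
Local Notation iter_ := (racg_iter ip mu M psi_s psi_n z0).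
Local Notation eta := (racg_eta ip mu psi_s psi_n z0).
Local Notation rr := (racg_r mu z0).
Local Notation test3 := (racg_test3 ip mu psi_s psi_n z0).
Local Notation test4 := (racg_test4 ip mu psi_s psi_n theta z0).
Local Notation test5 := (racg_test5 ip mu M psi_s psi_n z0).
Local Notation from := (racg_from ip mu M psi_s psi_n theta z0).

Lemma racg_eta_ge0 s : 0 <= eta s.
Proof. by rewrite le_max lexx. Qed.

(** * Termination of the inner loop *)

Hypothesis mu0 : 0 < mu.
Hypothesis muM : mu < M.
Hypothesis theta0 : 0 < theta.

(** With [D = |z - z0|] and [q = |B r + z - z0|], the third-step test gives [q^2 <= (1 + mu B) D^2]
    and [2 B eta <= D^2]. Hence [B^2 (|r|^2 + 2 eta) <= (4 + 2 mu B + B) D^2], which is at most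
    [(5 + 2 mu) B D^2] as [B >= 1]. *)
Lemma racg_test3_test4 s : 1 <= rB s -> 5 + 2 * mu <= theta ^+ 2 * rB s ->
  test3 s -> test4 s.
Proof.
rewrite /racg_test3 /racg_test4 => B1 Bth.
have := racg_eta_ge0 s; move: (eta s) => e.
set B := rB s in B1 Bth *; set r := rr s; set D := `|rz s - z0| => e0.
have mB0 : 0 < 1 + mu * B by have := mulr_gt0 mu0 (lt_le_trans ltr01 B1); lra.
have D0 : 0 <= D by exact: normr_ge0.
set q := `|_ + _ - _| => t3.
have q0 : 0 <= q by exact: normr_ge0.
have /ler_pM2l <- : 0 < B ^+ 2 by rewrite exprn_gt0//; lra.
have Br : B * `|r| <= q + D.
  have B0 : 0 <= B by lra.
  rewrite -[X in X * _](ger0_norm B0) -normrZ /q /D.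
  by rewrite -[X in `|X|](addrK (rz s - z0)) addrA (le_trans (ler_normB _ _)).
have r0 : 0 <= `|r| by exact: normr_ge0.
have q2 : q ^+ 2 <= (1 + mu * B) * D ^+ 2.
  rewrite -ler_pdivrMl//; apply: le_trans t3; rewrite lerDl.
  by rewrite !mulr_ge0//; lra.
have e2 : 2 * B * e <= D ^+ 2.
  apply: le_trans t3; rewrite lerDr mulr_ge0 ?sqr_ge0// invr_ge0 ltW//.
have Br2 : (B * `|r|) ^+ 2 <= 2 * q ^+ 2 + 2 * D ^+ 2.
  have : (B * `|r|) ^+ 2 <= (q + D) ^+ 2.
    by rewrite ler_pXn2r ?nnegrE ?addr_ge0// mulr_ge0//; lra.
  by have := sqr_ge0 (q - D); nra.
have DD : 0 <= D ^+ 2 by exact: sqr_ge0.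
have B0 : 0 <= B by lra.
have h1 := ler_wpM2r (mulr_ge0 B0 DD) Bth.
have h2 : B * (2 * B * e) <= B * D ^+ 2 by rewrite ler_wpM2l.
have h3 : D ^+ 2 <= B * D ^+ 2 by rewrite ler_peMl.
clear t3; clearbody B r D q; lra.
Qed.

(** The square root is at least [xi], so each increment is at least [xi], itself at least
    [1 / (M - mu)]. *)
Lemma racg_rB_ge j : j%:R / (M - mu) <= rB (iter_ j).
Proof.
have Mmu : 0 < M - mu by rewrite subr_gt0.
elim: j => [|j IHj]; first by rewrite mul0r.
rewrite /racg_iter iterS -/(racg_iter _ _ _ _ _ _ _) /racg_step/=.
set B := rB _ in IHj *.
have B0 : 0 <= B by rewrite (le_trans _ IHj) ?divr_ge0// ltW.
rewrite -natr1 mulrDl lerD// mul1r.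
have mB : 0 <= mu * B by rewrite mulr_ge0// ltW.
set xi := _ / (M - mu).
have xi1 : (M - mu)^-1 <= xi by rewrite ler_peMl ?invr_ge0 ?(ltW Mmu)//; lra.
have xi0 : 0 <= xi by rewrite (le_trans _ xi1)// invr_ge0 ltW.
have : xi <= Num.sqrt (xi ^+ 2 + 4 * xi * B).
  rewrite -{1}(ger0_norm xi0) -sqrtr_sqr ler_wsqrtr// lerDl.
  by rewrite mulr_ge0// mulr_ge0.
lra.
Qed.

Lemma racg_fromP j : exists o, from j o.
Proof.
have Mmu : 0 < M - mu by rewrite subr_gt0.
pose T := 1 + (5 + 2 * mu) / theta ^+ 2.
have th2 : 0 < theta ^+ 2 by rewrite exprn_gt0.
have Tge : 0 <= (5 + 2 * mu) / theta ^+ 2.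
  by rewrite divr_ge0 ?(ltW th2)//; have := mu0; lra.
have [N NT] : exists N : nat, T * (M - mu) <= N%:R.
  by exists (Num.truncn (T * (M - mu))).+1; rewrite ltW// truncnS_gt.
have large i : (N <= i)%N -> test3 (iter_ i) -> test4 (iter_ i).
  move=> Ni; have Ti : T <= rB (iter_ i).
    rewrite (le_trans _ (racg_rB_ge i))// ler_pdivlMr//.
    by rewrite (le_trans NT)// ler_nat.
  apply: racg_test3_test4; first by apply: le_trans Ti; rewrite lerDl.
  rewrite [leRHS]mulrC -ler_pdivrMr//; apply: le_trans Ti; rewrite lerDr//.
(* Induction on [k], a bound on the iterations left before [N], from which on passing the third-step
   test forces the loop to halt. *)
suff: forall k i, (N <= i + k)%N -> exists o, from i o.
  by move=> /(_ N j); apply; rewrite leq_addl.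
elim=> [|k IHk] i Nik.
  rewrite addn0 in Nik.
  case t3 : (test3 (iter_ i)); last first.
    by exists None; apply: racg_fail3; rewrite t3.
  case t5 : (test5 (iter_ i)); last first.
    by exists None; apply: racg_fail5; rewrite ?large ?t3 ?t5.
  by eexists; apply: racg_success; rewrite ?large ?t3.
case t3 : (test3 (iter_ i)); last first.
  by exists None; apply: racg_fail3; rewrite t3.
case t4 : (test4 (iter_ i)); last first.
  have [|o oP] := IHk i.+1; first by rewrite addSnnS.
  by exists o; apply: racg_next; rewrite ?t3 ?t4.
case t5 : (test5 (iter_ i)); last first.
  by exists None; apply: racg_fail5; rewrite ?t3 ?t4 ?t5.
by eexists; apply: racg_success; rewrite ?t3 ?t4.
Qed.

Lemma racg_from_Some j y v eps : from j (Some (y, v, eps)) ->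
  exists2 i, (j <= i)%N & let s := iter_ i in
  [/\ test4 s, test5 s, y = rz s, v = rr s & eps = eta s].
Proof.
move En : (Some (y, v, eps)) => o oP; elim: oP En => {j o} // j.
  by move=> o _ _ _ IH /IH[i ji si]; exists i => //; exact: ltnW.
by move=> _ t4 t5 [-> -> ->]; exists j.
Qed.

(** * One accelerated step and its invariant *)

Hypothesis ipN : norm_induced_by ip.
Hypothesis fd : finite_dimensional Z.
Hypothesis nC : Conv_bar psi_n.

Lemma racg_step_argmin s :
  let B := rB (step s) in
  let zt := (rB s / B) *: rz s + ((B - rB s) / B) *: rzc s in
  edom psi_n (rz (step s)) /\ forall u, edom psi_n u ->
    fine (psi_n (rz (step s))) +
      ip (M *: (zt - rz (step s)) - grad ip psi_s zt) (u - rz (step s))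
    <= fine (psi_n u).
Proof.
move=> B zt.
have := argmin_quadP (ip := ip) ipN fd
  (k := psi_s zt - ip (grad ip psi_s zt) zt) (a := grad ip psi_s zt) (p := zt)
  (F := fun u => ((lin ip psi_s u zt)%:E + psi_n u
                            + (M / 2 * `|u - zt| ^+ 2)%:E)%E) nC
  (lt_trans mu0 muM).
have -> : rz (step s) = argmin (fun u => ((lin ip psi_s u zt)%:E + psi_n u
                            + (M / 2 * `|u - zt| ^+ 2)%:E)%E).
  by rewrite /zt /B /=; rewrite [_ + _ - rB s]addrAC subrr add0r.
apply=> u; rewrite addeAC -EFinD; congr (_%:E + _)%E.
by rewrite /lin !(ipE ip); lra.
Qed.

Lemma RP_argmin y v : let yr := (RP ip M psi_s psi_n y v).1 in
  edom psi_n yr /\ forall u, edom psi_n u ->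
    fine (psi_n yr) + ip (M *: (y - yr) - (grad ip psi_s y - v)) (u - yr)
    <= fine (psi_n u).
Proof.
apply: (argmin_quadP (k := 0) ipN fd nC (lt_trans mu0 muM)) => u.
by rewrite add0r.
Qed.

(** The increment is the positive root of [b^2 = xi (B + b)]; this equation is what later turns the
    error of a step into a perfect square. *)
Lemma racg_step_rB s : 0 <= rB s -> rB s < rB (step s) /\
  (M - mu) * (rB (step s) - rB s) ^+ 2 = (1 + mu * rB s) * rB (step s).
Proof.
rewrite /racg_step/=; set B := rB s => B0.
have Mmu : 0 < M - mu by rewrite subr_gt0.
have mB : 0 <= mu * B by rewrite mulr_ge0// ltW.
set xi := _ / (M - mu).
have xi0 : 0 < xi by rewrite divr_gt0//; lra.
have xiE : (M - mu) * xi = 1 + mu * B by rewrite mulrC divfK// gt_eqF.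
rewrite -xiE; clearbody xi.
have d0 : 0 <= xi ^+ 2 + 4 * xi * B.
  by rewrite addr_ge0 ?sqr_ge0// !mulr_ge0// ltW.
have := sqr_sqrtr d0; have := sqrtr_ge0 (xi ^+ 2 + 4 * xi * B).
move: (Num.sqrt _) => q q0 qE; split; first lra.
rewrite [B + _ - B]addrAC subrr add0r -mulrA; congr (_ * _).
by rewrite exprMn sqrrD qE; field.
Qed.

Lemma racg_step_rzc s d : 0 <= rB s ->
  let b := rB (step s) - rB s in
  let zt := (rB s / rB (step s)) *: rz s + (b / rB (step s)) *: rzc s in
  (1 + mu * rB (step s)) * ip (rzc (step s)) d =
  (1 + mu * rB s) * ip (rzc s) d
  - b * (M - mu) * ip (zt - rz (step s)) d + mu * b * ip (rz (step s)) d.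
Proof.
move=> B0 b zt; have [BB' _] := racg_step_rB B0.
have bE : b = rB (step s) - rB s by [].
have ztE : zt = (rB s / rB (step s)) *: rz s + (b / rB (step s)) *: rzc s by [].
have zcE : rzc (step s) = (1 + mu * rB (step s))^-1 *:
   (rzc s - (b * (M - mu)) *: (zt - rz (step s)) +
    mu *: (rB s *: rzc s + b *: rz (step s))).
  by rewrite ztE bE /=; rewrite [X in X - rB s]addrC addrK.
have B'0 : 0 < 1 + mu * rB (step s).
  by rewrite ltr_pwDl// mulr_ge0 ?ltW// (le_lt_trans B0).
rewrite zcE (ipZl ip) mulrA divff ?gt_eqF// mul1r !(ipE ip).
by rewrite /b; ring.
Qed.

Lemma racg_step_rGamma s u : 0 <= rB s ->
  let b := rB (step s) - rB s in
  let zt := (rB s / rB (step s)) *: rz s + (b / rB (step s)) *: rzc s in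
  rB (step s) * rGamma (step s) u = rB s * rGamma s u + b *
    (lin ip psi_s (rz (step s)) zt + fine (psi_n (rz (step s)))
     + mu / 2 * `|rz (step s) - zt| ^+ 2
     + (M - mu) * ip (zt - rz (step s)) (u - rz (step s))
     + mu / 2 * `|u - rz (step s)| ^+ 2).
Proof.
move=> B0 b zt; have [BB' _] := racg_step_rB B0.
have bE : b = rB (step s) - rB s by [].
have ztE : zt = (rB s / rB (step s)) *: rz s + (b / rB (step s)) *: rzc s by [].
have [nz _] := racg_step_argmin s.
have -> : rGamma (step s) u = rB s / rB (step s) * rGamma s u +
    b / rB (step s) * (fine ((lin ip psi_s (rz (step s)) zt)%:E +
      psi_n (rz (step s)) + (mu / 2 * `|rz (step s) - zt| ^+ 2)%:E)%E
     + (M - mu) * ip (zt - rz (step s)) (u - rz (step s))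
     + mu / 2 * `|u - rz (step s)| ^+ 2).
  by rewrite ztE bE /=; rewrite [X in X - rB s]addrC addrK.
rewrite -(Conv_bar_fineK nC nz) -!EFinD.
have B'0 : rB (step s) != 0 by rewrite gt_eqF// (le_lt_trans B0).
by rewrite [fine _]/=; field; exact: B'0.
Qed.

(** Nesterov's estimate sequence: the third clause makes [zc] the minimizer of the quadratic
    [B Gam + |. - z0|^2 / 2], of curvature [1 + mu B], and the fourth bounds [B psi (z)] by the
    minimum. *)
Definition racg_invariant (B : R) z zc (Gam : Z -> R) : Prop :=
  [/\ 0 <= B, edom psi_n z,
      forall u, B * Gam u + `|u - z0| ^+ 2 / 2 =
        B * Gam zc + `|zc - z0| ^+ 2 / 2 + (1 + mu * B) / 2 * `|u - zc| ^+ 2,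
      B * (psi_s z + fine (psi_n z)) <= B * Gam zc + `|zc - z0| ^+ 2 / 2
    & forall u, edom psi_n u -> B * Gam u <= B * (psi_s u + fine (psi_n u))].

Hypothesis psi_upper : forall u y,
  psi_s u - lin ip psi_s u y <= M / 2 * `|u - y| ^+ 2.
Hypothesis psi_lower : forall u y,
  mu / 2 * `|u - y| ^+ 2 <= psi_s u - lin ip psi_s u y.

Lemma racg_invariant_next (B b : R) z zc Gam zt z' zc' Gam' :
  racg_invariant B z zc Gam -> 0 < b ->
  (M - mu) * b ^+ 2 = (1 + mu * B) * (B + b) ->
  (forall d, (B + b) * ip zt d = B * ip z d + b * ip zc d) ->
  edom psi_n z' ->
  (forall u, edom psi_n u ->
    fine (psi_n z') + ip (M *: (zt - z') - grad ip psi_s zt) (u - z')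
      <= fine (psi_n u)) ->
  (forall d, (1 + mu * (B + b)) * ip zc' d = (1 + mu * B) * ip zc d
     - b * (M - mu) * ip (zt - z') d + mu * b * ip z' d) ->
  (forall u, (B + b) * Gam' u = B * Gam u + b *
    (lin ip psi_s z' zt + fine (psi_n z') + mu / 2 * `|z' - zt| ^+ 2
     + (M - mu) * ip (zt - z') (u - z') + mu / 2 * `|u - z'| ^+ 2)) ->
  racg_invariant (B + b) z' zc' Gam'.
Proof.
move=> [B0 nz quad ub lb] b0 bsq ztE nz' nvar zc'E.
move g0E : (_ + mu / 2 * `|z' - zt| ^+ 2) => g0.
pose gam u := g0 + (M - mu) * ip (zt - z') (u - z') + mu / 2 * `|u - z'| ^+ 2.
move=> GE; have {}GE u : (B + b) * Gam' u = B * Gam u + b * gam u by rewrite GE.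
have mup := mu0; have muM' := muM.
have tau0 : 0 < 1 + mu * B by have := mulr_ge0 (ltW mu0) B0; lra.
have B'0 : 0 < B + b by lra.
(* Strong convexity of [psi_s] at [zt] and the proximal inequality at [z'] add up to exactly this
   bound. *)
have gam_le u : edom psi_n u -> gam u <= psi_s u + fine (psi_n u).
  move=> /nvar; have := psi_lower u zt.
  rewrite /gam -g0E /lin !ipN !(ipE ip).
  rewrite (ipC ip z' u) (ipC ip z' zt) (ipC ip zt u).
  lra.
(* The old quadratic plus the new model, recentred at its minimizer [zc']. *)
have key u : (1 + mu * B) / 2 * `|u - zc| ^+ 2 + b * gam u =
    (1 + mu * B) / 2 * `|zc' - zc| ^+ 2 + b * gam zc'
    + (1 + mu * (B + b)) / 2 * `|u - zc'| ^+ 2.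
  have := zc'E u; have := zc'E zc'.
  rewrite /gam !ipN !(ipE ip) (ipC ip u zc') (ipC ip u zc) (ipC ip zc' zc).
  rewrite (ipC ip u z') (ipC ip zc' z').
  lra.
have [w wE] : exists w, zt - z' = w by exists (zt - z').
have [e eE] : exists e, zc' - zc = e by exists (zc' - zc).
have gam_ge u : g0 + (M - mu) * ip w (u - z') <= gam u.
  by rewrite /gam -wE lerDl mulr_ge0 ?sqr_ge0// divr_ge0 ?ltW.
clearbody gam.
split.
- exact: ltW.
- by [].
- move=> u; rewrite !GE.
  by have := key u; have := quad u; have := quad zc'; move=> *; lra.
- rewrite GE.
  (* The upper curvature [M] exceeds the curvature [mu] already counted in [g0], whence the factor
     [M - mu]. *)
  have up : (B + b) * (psi_s z' + fine (psi_n z')) <=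
      (B + b) * (g0 + (M - mu) / 2 * `|w| ^+ 2).
    rewrite ler_pM2l//; have := psi_upper z' zt.
    by rewrite -g0E -wE [`|zt - z'|]distrC; move: (lin _ _ _ _) => *; lra.
  (* Since [zt] averages [z] and [zc], the linear terms of the model at [z] and [zc'] combine into
     [|w|^2] and a cross term with the displacement [e]. *)
  have convx : B * ip w (z - z') + b * ip w (zc' - z') =
      (B + b) * `|w| ^+ 2 + b * ip w e.
    have -> : `|w| ^+ 2 = ip w zt - ip w z' by rewrite ipN -{2}wE !(ipE ip).
    have := ztE w; rewrite -eE !(ipE ip).
    by rewrite (ipC ip zt w) (ipC ip z w) (ipC ip zc w) => *; lra.
  (* [0 <= (1 + mu B) / 2 * |e + (M - mu) b / (1 + mu B) w|^2] *)
  have square : - ((M - mu) / 2 * (B + b) * `|w| ^+ 2) <=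
      (1 + mu * B) / 2 * `|e| ^+ 2 + (M - mu) * b * ip w e.
    rewrite -subr_ge0.
    have -> : (1 + mu * B) / 2 * `|e| ^+ 2 + (M - mu) * b * ip w e
        - - ((M - mu) / 2 * (B + b) * `|w| ^+ 2) =
        (1 + mu * B) / 2 * `|e + ((M - mu) * b / (1 + mu * B)) *: w| ^+ 2.
      have -> : (M - mu) / 2 * (B + b) * `|w| ^+ 2 =
          (M - mu) * b ^+ 2 * (M - mu) / (2 * (1 + mu * B)) * `|w| ^+ 2.
        by rewrite bsq; field; rewrite gt_eqF.
      by rewrite !ipN !(ipE ip) (ipC ip e w); field; rewrite gt_eqF.
    by rewrite mulr_ge0 ?sqr_ge0// divr_ge0 ?ltW.
  have := quad zc'; rewrite eE.
  have := ler_wpM2l B0 (le_trans (gam_ge _) (gam_le _ nz)).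
  have := ler_wpM2l (ltW b0) (gam_ge zc').
  have : (M - mu) * (B * ip w (z - z') + b * ip w (zc' - z')) =
      (M - mu) * ((B + b) * `|w| ^+ 2 + b * ip w e) by rewrite convx.
  clear gam_le key zc'E nvar; move=> *; lra.
- by move=> u nu; rewrite GE !mulrDl lerD ?lb// ler_pM2l// gam_le.
Qed.

Hypothesis nz0 : edom psi_n z0.

Lemma racg_invariant_init : racg_invariant 0 z0 z0 (fun=> 0).
Proof.
split=> //; first by move=> u; rewrite subrr normr0; field.
  by rewrite !mul0r add0r subrr normr0 expr0n mul0r.
by move=> u _; rewrite !mul0r.
Qed.

Lemma racg_invariantP j : let s := iter_ j in
  racg_invariant (rB s) (rz s) (rzc s) (rGamma s).
Proof.
elim: j => [|j]; first exact: racg_invariant_init.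
rewrite /racg_iter iterS -/(racg_iter _ _ _ _ _ _ _).
move: (iter_ j) => s; cbv zeta => inv.
have B0 : 0 <= rB s by case: inv.
have [BB' bsq] := racg_step_rB B0.
have [nz' nvar] := racg_step_argmin s.
have B'E : rB (step s) = rB s + (rB (step s) - rB s) by rewrite addrC subrK.
rewrite {1}B'E; apply: (racg_invariant_next inv) nz' nvar _ _.
- by rewrite subr_gt0.
- by rewrite -B'E.
- move=> d; rewrite -B'E !(ipE ip); field.
  by rewrite gt_eqF// (le_lt_trans B0).
- by move=> d; rewrite -B'E racg_step_rzc.
- by move=> u; rewrite -B'E racg_step_rGamma.
Qed.

(** * Consequences of the invariant for the residual and the tests *)

Section FinalStep.
Variables (B : R) (z zc r : Z) (Gam : Z -> R).
Hypothesis inv : racg_invariant B z zc Gam.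
Hypothesis B0 : 0 < B.
Hypothesis rE : forall d,
  B * ip r d = ip z0 d - ip zc d + mu * B * (ip z d - ip zc d).

Let inner := psi_s z + fine (psi_n z) - Gam zc - ip r (z - zc)
             + mu / 2 * `|z - zc| ^+ 2.

(** With [Gam u] in place of the value of [psi] at [u], the left side does not depend on [u]: the
    choice of [r] cancels the linear terms and the [mu] terms cancel the curvature. At [u = zc] it
    equals [inner], and [Gam] lies below [psi]. *)
Lemma racg_gap_le u : edom psi_n u ->
  psi_s z + fine (psi_n z) - (psi_s u + fine (psi_n u)) - ip r (z - u)
  + mu / 2 * `|u - z| ^+ 2 <= inner.
Proof.
move=> nu; have [_ _ quad _ /(_ u nu) lb] := inv.
have quadu := quad u.
have ru := rE u; have rzc := rE zc.
rewrite -(ler_pM2l B0) /inner.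
move: (psi_s z + _) (psi_s u + _) lb => Pz Pu lb.
move: quadu; rewrite !ipN !(ipE ip).
rewrite (ipC ip z0 u) (ipC ip z0 zc) (ipC ip zc u) (ipC ip z u) (ipC ip z zc).
rewrite (ipC ip z0 u) (ipC ip z0 zc) (ipC ip zc u) (ipC ip z u) (ipC ip z zc)
  in ru rzc.
move: (ip r u) (ip r zc) (ip r z) ru rzc => *; lra.
Qed.

(** The gap bound at [u = z] has left side zero. Hence the maximum with [0] in [eta] changes
    nothing. *)
Lemma racg_inner_ge0 : 0 <= inner.
Proof.
have [_ nz _ _ _] := inv; have := racg_gap_le nz.
by rewrite !subrr ip0r normr0 expr0n mulr0 subr0 addr0.
Qed.

(** As [B r + z - z0 = (1 + mu B) (z - zc)], expanding both sides reduces the claim to the upper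
    bound on [B psi (z)] in the invariant. *)
Lemma racg_residual_le :
  (1 + mu * B)^-1 * `|B *: r + z - z0| ^+ 2 + 2 * B * inner <= `|z - z0| ^+ 2.
Proof.
have [_ _ _ ub _] := inv.
have tau0 : 0 < 1 + mu * B by rewrite ltr_pwDl// mulr_ge0 ?ltW.
have -> : B *: r + z - z0 = (1 + mu * B) *: (z - zc).
  by apply: (@ip_inj _ _ ip) => d; rewrite !(ipE ip) rE; ring.
have -> : (1 + mu * B)^-1 * `|(1 + mu * B) *: (z - zc)| ^+ 2 =
    (1 + mu * B) * `|z - zc| ^+ 2.
  by rewrite normrZ gtr0_norm//; field; rewrite gt_eqF.
have -> : 2 * B * inner = 2 * (B * (psi_s z + fine (psi_n z)) - B * Gam zc
   - B * ip r (z - zc) + mu * B / 2 * `|z - zc| ^+ 2) by rewrite /inner; field.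
rewrite rE; move: ub.
rewrite !ipN !(ipE ip).
rewrite (ipC ip z0 zc) (ipC ip z zc) (ipC ip z0 z).
by move: (B * (_ + _)) => *; lra.
Qed.

End FinalStep.

Lemma racg_iterS_rB_gt0 j : 0 < rB (iter_ j.+1).
Proof.
rewrite (lt_le_trans _ (racg_rB_ge _))// divr_gt0// ?ltr0n// subr_gt0//.
Qed.

Lemma racg_rE s d : 0 < rB s -> rB s * ip (rr s) d =
  ip z0 d - ip (rzc s) d + mu * rB s * (ip (rz s) d - ip (rzc s) d).
Proof. by move=> B0; rewrite /racg_r !(ipE ip); field; rewrite gt_eqF. Qed.

Lemma racg_etaE j : let s := iter_ j.+1 in
  eta s = psi_s (rz s) + fine (psi_n (rz s)) - rGamma s (rzc s)
    - ip (rr s) (rz s - rzc s) + mu / 2 * `|rz s - rzc s| ^+ 2.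
Proof.
cbv zeta; have := racg_invariantP j.+1; have := racg_iterS_rB_gt0 j.
move: (iter_ j.+1) => s; cbv zeta => B0 inv.
have := racg_inner_ge0 inv B0 (fun d => racg_rE d B0).
rewrite /racg_eta /psi; have [_ nz _ _ _] := inv.
rewrite -(Conv_bar_fineK nC nz) -EFinD /=.
by move=> /max_idPr.
Qed.

Lemma racg_test3_holds j : test3 (iter_ j.+1).
Proof.
rewrite /racg_test3 racg_etaE.
exact: (racg_residual_le (racg_invariantP j.+1) (racg_iterS_rB_gt0 j)
   (fun d => racg_rE d (racg_iterS_rB_gt0 j))).
Qed.

(** Taken at the refined point this is the fifth-step test; taken at [z0] it is the test of the
    outer method. *)
Lemma racg_Delta_le_eta j u : edom psi_n u ->
  (Delta ip mu psi_s psi_n u (rz (iter_ j.+1)) (rr (iter_ j.+1))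
    <= (eta (iter_ j.+1))%:E)%E.
Proof.
move=> nu; rewrite racg_etaE.
have := racg_gap_le (racg_invariantP j.+1) (racg_iterS_rB_gt0 j)
   (fun d => racg_rE d (racg_iterS_rB_gt0 j)) nu.
have [_ nz _ _ _] := racg_invariantP j.+1.
rewrite /Delta /psi -(Conv_bar_fineK nC nz) -(Conv_bar_fineK nC nu).
by rewrite -!EFinD -?EFinB -?EFinD lee_fin.
Qed.

Lemma racg_from_not_None j : ~ from j.+1 None.
Proof.
move En : (@None (Z * Z * R)) => o; move Ej : j.+1 => i oP.
elim: oP j Ej En => {o i} // i.
- by move=> nt3 j ij; rewrite -ij racg_test3_holds in nt3.
- by move=> o _ _ _ IH j ij eo; apply: (IH j.+1) => //; rewrite ij.
- move=> _ _ /negP nt5 j ij; case: nt5; rewrite -ij.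
  apply: racg_Delta_le_eta.
  by have [] := RP_argmin (rz (iter_ j.+1)) (rr (iter_ j.+1)).
Qed.

End RACGTheory.

(** * The static IA-ICG method *)

Section OuterMethod.
Context {R : realType} {Z : normedModType R} (ip : {dot Z for (@idfun R)}).
Variables (f1 f2 : Z -> R) (h : Z -> \bar R) (M2 lambda theta rho : R).
Implicit Types (u v w x y : Z).

Hypothesis ipN : norm_induced_by ip.
Hypothesis fd : finite_dimensional Z.
Hypothesis hC : Conv_bar h.
Hypothesis df2 : forall x, differentiable f2 x.
Hypothesis lambda0 : 0 < lambda.
Hypothesis theta0 : 0 < theta.
Hypothesis M2p0 : 0 < Num.max M2 0.

Local Notation psis := (ia_psi_s ip f1 f2 lambda).
Local Notation psin := (ia_psi_n h lambda).
Local Notation MM := (ia_M M2 lambda).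
Local Notation iaRP y := (RP ip MM (psis y) psin).

Lemma ia_M_gt1 : 1 < MM.
Proof. by rewrite /ia_M ltrDr mulr_gt0. Qed.

Lemma ia_psi_n_Conv_bar : Conv_bar psin.
Proof. exact: Conv_bar_scale. Qed.

Lemma edom_ia_psi_n u : edom psin u <-> edom h u.
Proof.
rewrite /edom/= /ia_psi_n; split=> hu; last first.
  by rewrite -(Conv_bar_fineK hC hu) -EFinM ltry.
apply: contrapT => /Conv_bar_notin hoo; move: hu.
by rewrite hoo gt0_muley ?lte_fin// ltxx.
Qed.

Lemma fine_ia_psi_n u : edom h u -> fine (psin u) = lambda * fine (h u).
Proof. by move=> hu; rewrite /ia_psi_n -(Conv_bar_fineK hC hu) -EFinM. Qed.

Lemma grad_psis y x : grad ip (psis y) x =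
  lambda *: (grad ip f1 y + grad ip f2 x) + (x - y).
Proof. exact: grad_ia_psi_s. Qed.

Lemma ia_psi_s_gap y u x : psis y u - lin ip (psis y) u x =
  lambda * (f2 u - lin ip f2 u x) + `|u - x| ^+ 2 / 2.
Proof.
rewrite /(lin ip (psis y)) grad_psis /ia_psi_s /lin !ipN !(ipE ip).
by rewrite (ipC ip x u) (ipC ip y u) (ipC ip y x); field.
Qed.

Lemma ia_RP_argmin y yk v : let yr := (iaRP y yk v).1 in
  edom h yr /\ forall u, edom h u ->
    lambda * fine (h yr)
    + ip (MM *: (yk - yr) - (grad ip (psis y) yk - v)) (u - yr)
    <= lambda * fine (h u).
Proof.
cbv zeta.
have [nyr nmin] := RP_argmin (psis y) ltr01 ia_M_gt1 ipN fd
  ia_psi_n_Conv_bar yk v.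
move: (RP _ _ _ _ _ _) nyr nmin => [yr vr] /= /edom_ia_psi_n hyr nmin.
split=> // u hu; rewrite -!fine_ia_psi_n//; apply: nmin.
exact/edom_ia_psi_n.
Qed.

Local Notation Srp := (SRP ip f1 f2 h M2 lambda).

(** Regroups the residual into terms that are each controlled by [|yk - y|] or [|yk - yr|]; the
    proximal term in [psi_s] turns [M] into [M - 1]. *)
Lemma SRPE yk v y : let yr := (iaRP y yk v).1 in
  Srp yk v y = (yr,
    lambda^-1 *: (v + (MM - 1) *: (yk - yr) + (y - yr))
    + (grad ip f2 yr - grad ip f2 yk) + (grad ip f1 yr - grad ip f1 y)).
Proof.
cbv zeta; rewrite /SRP /RP /=; set yr := argmin _.
congr (_, _).
rewrite !grad_psis; apply: (@ip_inj _ _ ip) => d.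
have l0 : lambda != 0 by rewrite gt_eqF.
move: (grad ip f1 y) (grad ip f1 yr) (grad ip f2 yr) (grad ip f2 yk) MM.
by move: yr => yr *; rewrite !(ipE ip); field.
Qed.

(** The subgradient of [lambda h] provided by the proximal subproblem, divided by [lambda], is what
    remains of the residual after the two gradients. *)
Lemma SRP_subdiff yk v y : let s := Srp yk v y in
  exists2 w, subdiff ip h s.1 w & s.2 = grad ip f1 s.1 + grad ip f2 s.1 + w.
Proof.
cbv zeta; rewrite SRPE; have [hyr hmin] := ia_RP_argmin y yk v.
set yr := (RP _ _ _ _ _ _).1 in hyr hmin *; rewrite [(_, _).1]/= [(_, _).2]/=.
clearbody yr.
exists (lambda^-1 *: (MM *: (yk - yr) - (grad ip (psis y) yk - v))).
  move=> u; have [hu|/Conv_bar_notin ->] := pselect (edom h u); last first.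
    exact: leey.
  rewrite -(Conv_bar_fineK hC hyr) -(Conv_bar_fineK hC hu) -EFinD lee_fin.
  by rewrite -(ler_pM2l lambda0) mulrDr ipZl mulVKf ?gt_eqF// hmin.
rewrite grad_psis; apply: (@ip_inj _ _ ip) => d.
have l0 : lambda != 0 by rewrite gt_eqF.
move: (grad ip f1 y) (grad ip f1 yr) (grad ip f2 yr) (grad ip f2 yk) MM.
by move=> *; rewrite !(ipE ip); field.
Qed.

Local Notation racg := (ia_racg ip f1 f2 h M2 lambda theta).
Local Notation from := (iaicg_from ip f1 f2 h M2 lambda theta rho).

Lemma iaicg_from_Some k y K yh vh : from k y K (Some (yh, vh)) ->
  (exists2 w, subdiff ip h yh w & vh = grad ip f1 yh + grad ip f2 yh + w)
  /\ `|vh| <= rho.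
Proof.
move En : (Some (yh, vh)) => o oP; elim: oP En => {k y K o} //.
move=> k y yk vk ek _ _ small eE.
have sE : (yh, vh) = Srp yk vk y := congr1 (odflt (0, 0)) eE.
have := SRP_subdiff yk vk y; rewrite -sE in small * => sub.
by split; [exact: sub|exact: small].
Qed.

Lemma ia_racg_Some y yk vk ek : racg y (Some (yk, vk, ek)) ->
  [/\ edom h yk, 0 <= ek, `|vk| ^+ 2 + 2 * ek <= theta ^+ 2 * `|yk - y| ^+ 2
    & (ia_Delta ip f1 f2 h lambda y (iaRP y yk vk).1 yk vk <= ek%:E)%E].
Proof.
move=> /racg_from_Some[[//|i] _ [t4 t5 -> -> ->]]; split => //.
  have [] := racg_step_argmin (psis y) ltr01 ia_M_gt1 ipN fd ia_psi_n_Conv_bar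
    (racg_iter ip 1 MM (psis y) psin y i).
  by move=> /edom_ia_psi_n.
exact: racg_eta_ge0.
Qed.

Lemma ia_DeltaE y u x v : edom h u -> edom h x ->
  ia_Delta ip f1 f2 h lambda y u x v =
  (psis y x + lambda * fine (h x) - (psis y u + lambda * fine (h u))
   - ip v (x - u) + `|u - x| ^+ 2 / 2)%:E.
Proof.
move=> hu hx; rewrite /ia_Delta /Delta /psi /ia_psi_n.
rewrite -(Conv_bar_fineK hC hu) -(Conv_bar_fineK hC hx) /=.
by congr (_%:E); field.
Qed.

(** * Descent per outer iteration and the iteration bound *)

Section Descent.
Variables (M1 L1 L2 : R).
Hypothesis upper1 : forall u y, edom h u -> edom h y ->
  f1 u - lin ip f1 u y <= M1 / 2 * `|u - y| ^+ 2.
Hypothesis upper2 : forall u y, edom h u -> edom h y ->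
  f2 u - lin ip f2 u y <= M2 / 2 * `|u - y| ^+ 2.
Hypothesis lip1 : grad_lipschitz ip f1 h L1.
Hypothesis lip2 : grad_lipschitz ip f2 h L2.
Hypothesis L1_ge0 : 0 <= L1.
Hypothesis L2_ge0 : 0 <= L2.
Hypothesis theta1 : theta < 1.
Hypothesis stepsize : lambda * M1 + theta ^+ 2 <= 1 / 2.

Definition objective u : R := f1 u + f2 u + fine (h u).

(** Young's inequality replaces [ip vk (yk - y)] by half of [|vk|^2 + |yk - y|^2], the fourth-step
    test bounds [|vk|^2 + 2 ek], and the stepsize condition leaves a quarter of [|yk - y|^2]. *)
Lemma ia_descent y yk vk ek : edom h y -> racg y (Some (yk, vk, ek)) ->
  (ia_Delta ip f1 f2 h lambda y y yk vk <= ek%:E)%E ->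
  `|yk - y| ^+ 2 <= 4 * lambda * (objective y - objective yk).
Proof.
move=> hy /ia_racg_Some[hyk ek0 vek _].
rewrite ia_DeltaE// lee_fin => De.
have := upper1 hyk hy; have := stepsize; have := lambda0.
have vsq : 0 <= `|vk - (yk - y)| ^+ 2 by exact: sqr_ge0.
have vE : `|vk - (yk - y)| ^+ 2 =
    `|vk| ^+ 2 - 2 * ip vk (yk - y) + `|yk - y| ^+ 2.
  by rewrite !ipN !(ipE ip) (ipC ip yk vk) (ipC ip y vk); ring.
rewrite vE in vsq.
have lin_yy : lin ip f1 y y = f1 y by rewrite /lin subrr ip0r addr0.
move: De; rewrite /ia_psi_s /objective lin_yy subrr normr0.
rewrite (_ : 0 ^+ 2 = 0 :> R) ?expr0n//.
rewrite [`|y - yk|]distrC.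
move: vsq vek; move: (ip vk _) (lin _ _ _ _) => q ell.
set D : R := `|yk - y| ^+ 2; have D0 : 0 <= D by exact: sqr_ge0.
clearbody D => vsq vek De l0 ss up.
have lup := ler_wpM2l (ltW l0) up.
have ssD := ler_wpM2r D0 ss.
lra.
Qed.

(** The proximal inequality at [yk] and the upper curvature of [psi_s] force a decrease of at least
    [M / 2 * |yk - yr|^2], which the fifth-step test caps by [ek]; the fourth-step test bounds
    [2 ek]. *)
Lemma ia_RP_close y yk vk ek : edom h y -> racg y (Some (yk, vk, ek)) ->
  Num.sqrt MM * `|yk - (iaRP y yk vk).1| <= theta * `|yk - y|.
Proof.
move=> hy /ia_racg_Some[hyk ek0 vek].
have [hyr /(_ yk hyk)] := ia_RP_argmin y yk vk.
set yr := (RP _ _ _ _ _ _).1 in hyr *.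
rewrite ia_DeltaE// lee_fin.
have MM0 : 0 <= MM by rewrite ltW// (lt_trans ltr01 ia_M_gt1).
have : lambda * (M2 / 2 * `|yr - yk| ^+ 2) <=
    lambda * Num.max M2 0 / 2 * `|yr - yk| ^+ 2.
  have : M2 <= Num.max M2 0 by rewrite le_max lexx.
  move=> /(ler_wpM2l (ltW lambda0)) M2le.
  by have := ler_wpM2r (sqr_ge0 `|yr - yk|) M2le; lra.
have := ler_wpM2l (ltW lambda0) (upper2 hyr hyk).
have := ia_psi_s_gap y yr yk.
rewrite [`|yr - yk|]distrC /(lin _ (psis y)).
have -> : ip (MM *: (yk - yr) - (grad ip (psis y) yk - vk)) (yk - yr) =
    MM * `|yk - yr| ^+ 2 + ip (grad ip (psis y) yk) (yr - yk)
    + ip vk (yk - yr) by rewrite !ipN !(ipE ip); ring.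
move: (ip _ (yr - yk)) (ip vk _) (lin _ _ _ _) (psis y yr) (psis y yk).
clearbody yr => a b c p q gap up M2le test var.
rewrite -(@ler_pXn2r _ 2)// ?nnegrE ?mulr_ge0 ?sqrtr_ge0 ?(ltW theta0)//.
rewrite !exprMn sqr_sqrtr//.
have v0 : 0 <= `|vk| ^+ 2 by exact: sqr_ge0.
have s0 : 0 <= `|yk - yr| ^+ 2 by exact: sqr_ge0.
have MME : MM * `|yk - yr| ^+ 2 =
    lambda * Num.max M2 0 * `|yk - yr| ^+ 2 + `|yk - yr| ^+ 2.
  by rewrite /ia_M mulrDl mul1r.
rewrite MME in test *; lra.
Qed.

Local Notation Cbar :=
  ((1 + lambda * (Num.max M2 0 + L1 + L2)) /
   Num.sqrt (1 + lambda * Num.max M2 0)).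

(** Triangle inequality on [SRPE]: the coefficients of [|yk - yr|] sum to the numerator of [Cbar],
    and its denominator comes from [ia_RP_close]. The factor 2 absorbs [theta < 1] from [|vk|]. *)
Lemma SRP_norm_le y yk vk ek : edom h y -> racg y (Some (yk, vk, ek)) ->
  lambda * `|(Srp yk vk y).2| <=
  2 * (1 + lambda * L1 + theta * Cbar) * `|yk - y|.
Proof.
move=> hy rk; have := ia_RP_close hy rk.
have [hyk ek0 vek _] := ia_racg_Some rk.
have [hyr _] := ia_RP_argmin y yk vk.
rewrite SRPE; set yr := (RP _ _ _ _ _ _).1 in hyr *; rewrite [(_, _).2]/=.
clearbody yr.
have MME : MM = 1 + lambda * Num.max M2 0 by rewrite /ia_M addrC.
rewrite -MME; have M0 : 0 < MM by rewrite (lt_trans ltr01 ia_M_gt1).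
have sM0 : 0 < Num.sqrt MM by rewrite sqrtr_gt0.
move=> close.
have vk_le : `|vk| <= theta * `|yk - y|.
  rewrite -(@ler_pXn2r _ 2)// ?nnegrE ?mulr_ge0 ?(ltW theta0)// exprMn.
  by apply: le_trans vek; rewrite lerDl mulr_ge0.
have tri : `|y - yr| <= `|yk - y| + `|yk - yr|.
  by rewrite [`|yk - y|]distrC (le_trans _ (ler_normD _ _))// addrA subrK.
have g1 := lip1 hyr hy; have g2 := lip2 hyr hyk.
rewrite [`|yr - y|]distrC in g1; rewrite [`|yr - yk|]distrC in g2.
set S := 1 + lambda * (Num.max M2 0 + L1 + L2).
have S0 : 0 <= S.
  by rewrite addr_ge0// mulr_ge0 ?addr_ge0// ltW.
have closeS : S * `|yk - yr| <= theta * (S / Num.sqrt MM) * `|yk - y|.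
  have -> : theta * (S / Num.sqrt MM) * `|yk - y| =
    S / Num.sqrt MM * (theta * `|yk - y|) by ring.
  have -> : S * `|yk - yr| = S / Num.sqrt MM * (Num.sqrt MM * `|yk - yr|).
    by rewrite mulrA divfK// gt_eqF.
  by rewrite ler_wpM2l// divr_ge0// ltW.
have -> : lambda * `|lambda^-1 *: (vk + (MM - 1) *: (yk - yr) + (y - yr)) +
    (grad ip f2 yr - grad ip f2 yk) + (grad ip f1 yr - grad ip f1 y)| =
   `|vk + (MM - 1) *: (yk - yr) + (y - yr) +
    lambda *: (grad ip f2 yr - grad ip f2 yk) +
    lambda *: (grad ip f1 yr - grad ip f1 y)|.
  rewrite -{1}(gtr0_norm lambda0) -normrZ; congr (`|_|).
  have l0 : lambda != 0 by rewrite gt_eqF.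
  by rewrite 2!scalerDr scalerA divff// scale1r.
have nD4 (a b c d e : Z) : `|a + b + c + d + e| <=
    `|a| + `|b| + `|c| + `|d| + `|e|.
  by do 4 (apply: (le_trans (ler_normD _ _)); apply: lerD => //).
apply: (le_trans (nD4 _ _ _ _ _)); rewrite !normrZ !(gtr0_norm lambda0).
have -> : `|MM - 1| = lambda * Num.max M2 0.
  by rewrite /ia_M addrK ger0_norm// mulr_ge0 ?(ltW lambda0)// ltW.
have := ler_wpM2l (ltW lambda0) g1; have := ler_wpM2l (ltW lambda0) g2.
have triL := ler_wpM2l (mulr_ge0 (ltW lambda0) L1_ge0) tri.
have th1 := ler_wpM2r (normr_ge0 (yk - y)) (ltW theta1).
have SE : S * `|yk - yr| = `|yk - yr| + lambda * Num.max M2 0 * `|yk - yr|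
  + lambda * L1 * `|yk - yr| + lambda * L2 * `|yk - yr| by rewrite /S; ring.
rewrite SE in closeS.
have L1y : 0 <= lambda * L1 * `|yk - y|.
  by rewrite !mulr_ge0// ltW.
have cS0 : 0 <= theta * (S / Num.sqrt MM) * `|yk - y|.
  by rewrite !mulr_ge0 ?divr_ge0 ?(ltW theta0)// ltW.
move: (Num.max M2 0) (theta * (S / _)) closeS cS0 => *.
lra.
Qed.

Lemma sqrt_lambda_rate : Num.sqrt lambda *
    (Num.sqrt lambda * L1 + (1 + theta * Cbar) / Num.sqrt lambda) =
  1 + lambda * L1 + theta * Cbar.
Proof.
have sl0 : 0 < Num.sqrt lambda by rewrite sqrtr_gt0.
rewrite mulrDr mulrA -expr2 sqr_sqrtr ?(ltW lambda0)//.
by rewrite mulrC [X in _ + X]mulrC divfK ?gt_eqF//; ring.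
Qed.

Local Notation rate :=
  (Num.sqrt lambda * L1 + (1 + theta * Cbar) / Num.sqrt lambda).

Lemma Cbar_ge0 : 0 <= Cbar.
Proof.
rewrite divr_ge0 ?sqrtr_ge0// addr_ge0// mulr_ge0 ?(ltW lambda0)//.
by rewrite !addr_ge0// ltW.
Qed.

Lemma rate_gt0 : 0 < rate.
Proof.
have tC := mulr_ge0 (ltW theta0) Cbar_ge0.
rewrite ltr_wpDl ?mulr_ge0 ?sqrtr_ge0// divr_gt0 ?sqrtr_gt0//.
by rewrite ltr_wpDr.
Qed.

(** The constant 16 is the square of the factor 2 in [SRP_norm_le] times the 4 in [ia_descent]. *)
Lemma SRP_sq_norm_le y yk vk ek : edom h y -> racg y (Some (yk, vk, ek)) ->
  (ia_Delta ip f1 f2 h lambda y y yk vk <= ek%:E)%E ->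
  `|(Srp yk vk y).2| ^+ 2 <= 16 * rate ^+ 2 * (objective y - objective yk).
Proof.
move=> hy rk De; have := ia_descent hy rk De; have := SRP_norm_le hy rk.
rewrite -sqrt_lambda_rate; have := rate_gt0.
move: rate (objective y - _) => A D A0.
have := normr_ge0 (yk - y); have := normr_ge0 (Srp yk vk y).2.
move: `|_| `|_| => d v v0 d0 vd dD.
rewrite -(ler_pM2l (exprn_gt0 2 lambda0)) -exprMn.
have s0 : 0 <= Num.sqrt lambda by exact: sqrtr_ge0.
have lv0 : 0 <= lambda * v by rewrite mulr_ge0// ltW.

have : (lambda * v) ^+ 2 <= (2 * (Num.sqrt lambda * A) * d) ^+ 2.
  by rewrite ler_pXn2r ?nnegrE ?(le_trans lv0 vd).
move/le_trans; apply.
rewrite !exprMn sqr_sqrtr ?(ltW lambda0)//.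
have := ler_wpM2l (mulr_ge0 (ltW lambda0) (sqr_ge0 A)) dD.
by move=> *; lra.
Qed.

Variable phi_star : R.
Hypothesis phi_star_le : forall u, edom h u -> phi_star <= objective u.
Hypothesis rho0 : 0 < rho.

(* Every unsuccessful outer iteration decreases the objective by at least
   [rho ^+ 2 / (16 * rate ^+ 2)]. *)
Lemma iaicg_from_bounded (n k : nat) y : edom h y ->
  16 * rate ^+ 2 * (objective y - phi_star) < n%:R * rho ^+ 2 ->
  exists K o, from k y K o /\
    (K%:R - k%:R) * rho ^+ 2 <= 16 * rate ^+ 2 * (objective y - phi_star).
Proof.
have A0 := exprn_gt0 2 rate_gt0; have r0 := exprn_gt0 2 rho0.
move: (rate ^+ 2) A0 SRP_sq_norm_le => A A0 sq_norm_le.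
have gap_ge0 u : edom h u -> 0 <= 16 * A * (objective u - phi_star).
  by move=> hu; rewrite !mulr_ge0 ?subr_ge0 ?phi_star_le// ltW.
(* [n] caps the number of decreases still possible; at [n = 0] the hypothesis contradicts that the
   gap is nonnegative. *)
elim: n k y => [|n IHn] k y hy gap.
  by move: gap; rewrite mul0r ltNge gap_ge0.
have stop o : from k y k o -> exists K o, from k y K o /\
    (K%:R - k%:R) * rho ^+ 2 <= 16 * A * (objective y - phi_star).
  by move=> ko; exists k, o; rewrite subrr mul0r gap_ge0.
have [[[[yk vk] ek]|] rk] :=
  racg_fromP ip (psis y) psin y ltr01 ia_M_gt1 theta0 1; last first.
  by apply: (stop None); exact: iaicg_fail1.
have [De|De] := boolP (ia_Delta ip f1 f2 h lambda y y yk vk <= ek%:E)%E;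
  last by apply: (stop None); exact: iaicg_fail2 rk De.
have [small|large] := boolP (`|(Srp yk vk y).2| <= rho).
  by apply: (stop (Some _)); exact: iaicg_success rk De small.
have [hyk _ _ _] := ia_racg_Some rk.
have dec : rho ^+ 2 <= 16 * A * (objective y - objective yk).
  apply: le_trans (sq_norm_le _ _ _ _ hy rk De).
  by rewrite ler_pXn2r ?nnegrE ?(ltW rho0)// ltW// ltNge.
have [|K [res [Kres KE]]] := IHn k.+1 yk hyk.
  by move: gap; rewrite -natr1 => *; lra.
exists K, res; split; first exact: iaicg_next rk De large Kres.
by move: KE; rewrite -(natr1 k) => *; lra.
Qed.

End Descent.

(** * Success when [f2] is convex *)

Hypothesis f2_convex : convex_function setT f2.
Hypothesis psis_upper : forall y, edom h y -> forall u x,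
  psis y u - lin ip (psis y) u x <= MM / 2 * `|u - x| ^+ 2.

Lemma psis_lower y u x :
  1 / 2 * `|u - x| ^+ 2 <= psis y u - lin ip (psis y) u x.
Proof.
rewrite ia_psi_s_gap mul1r [leLHS]mulrC lerDr mulr_ge0 ?(ltW lambda0)//.
rewrite subr_ge0; apply: convex_is_grad => //.
exact: differentiable_is_grad.
Qed.

Lemma ia_racg_not_None y : edom h y -> ~ racg y None.
Proof.
move=> hy; apply: (racg_from_not_None ltr01 ia_M_gt1 ipN fd ia_psi_n_Conv_bar).
- exact: psis_upper.
- exact: psis_lower.
- exact/edom_ia_psi_n.
Qed.

Lemma ia_racg_Delta y yk vk ek : edom h y -> racg y (Some (yk, vk, ek)) ->
  (ia_Delta ip f1 f2 h lambda y y yk vk <= ek%:E)%E.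
Proof.
move=> hy /racg_from_Some[[//|i] _ [_ _ -> -> ->]].
apply: (racg_Delta_le_eta ltr01 ia_M_gt1 ipN fd ia_psi_n_Conv_bar).
- exact: psis_upper.
- exact: psis_lower.
- exact/edom_ia_psi_n.
- exact/edom_ia_psi_n.
Qed.

Lemma iaicg_from_not_None k y K o : edom h y -> from k y K o -> o <> None.
Proof.
move=> hy Ko; elim: Ko hy => {k y K o} //.
- by move=> _ y rN hy; case: (ia_racg_not_None hy).
- by move=> _ y yk vk ek rk /negP De hy; case: De; exact: ia_racg_Delta rk.
- by move=> _ y yk vk ek K o rk _ _ _ IH hy; apply: IH; case: (ia_racg_Some rk).
Qed.

End OuterMethod.

Theorem theorem4 (R : realType) :
  exists2 C : R, 0 < C &
  forall (Z : normedModType R) (ip : {dot Z for (@idfun R)})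
    (f1 f2 : Z -> R) (h : Z -> \bar R) (m1 M1 m2 M2 : R)
    (rho lambda theta : R) (y0 : Z),
  let L1 := Num.max `|m1| `|M1| in
  let L2 := Num.max `|m2| `|M2| in
  let M2p := Num.max M2 0 in
  let phi := fun u => ((f1 u + f2 u)%:E + h u)%E in
  let phi_star := ereal_inf (range phi) in
  let Cbar := (1 + lambda * (M2p + L1 + L2)) / Num.sqrt (1 + lambda * M2p) in
  finite_dimensional Z ->
  norm_induced_by ip ->
  Conv_bar h ->
  cont_diff ip f1 -> cont_diff ip f2 ->
  curvature_bounds ip f1 h m1 M1 -> curvature_bounds ip f2 h m2 M2 ->
  grad_lipschitz ip f1 h L1 -> grad_lipschitz ip f2 h L2 ->
  (-oo < phi_star)%E ->
  0 < rho -> edom h y0 ->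
  0 < lambda -> 0 < theta < 1 ->
  lambda * M1 + theta ^+ 2 <= 1 / 2 ->
  (* the division by M - mu = lambda * M2p in the inner method is legitimate *)
  0 < M2p ->
  [/\ exists (K : nat) (o : option (Z * Z)),
        iaicg_halts ip f1 f2 h M2 lambda theta rho y0 K o /\
        (K%:R%:E <= C%:E * (1 +
           ((Num.sqrt lambda * L1 + (1 + theta * Cbar) / Num.sqrt lambda) ^+ 2)%:E
           * ((phi y0 - phi_star) * (rho ^- 2)%:E)))%E,
      forall (K : nat) (yh vh : Z),
        iaicg_halts ip f1 f2 h M2 lambda theta rho y0 K (Some (yh, vh)) ->
        (exists2 w, subdiff ip h yh w & vh = grad ip f1 yh + grad ip f2 yh + w)
        /\ `|vh| <= rho
    & convex_function setT f2 ->
      (* the instances passed to the inner method satisfy its input contract *)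
      (forall z0, edom h z0 -> ia_racg_input ip f1 f2 h M2 lambda theta z0) ->
      exists (K : nat) (yh vh : Z),
        iaicg_halts ip f1 f2 h M2 lambda theta rho y0 K (Some (yh, vh))].
Proof.
exists 16 => // Z ip f1 f2 h m1 M1 m2 M2 rho lambda theta y0 L1 L2 M2p phi
  phi_star Cbar fd ipN hC [df1 _] [df2 _] curv1 curv2 lip1 lip2 phi_star_gt
  rho0 hy0 lambda0 /andP[theta0 theta1] stepsize M2p0.
have upper1 u y : edom h u -> edom h y ->
    f1 u - lin ip f1 u y <= M1 / 2 * `|u - y| ^+ 2.
  by move=> hu hy; have /andP[] := curv1 u y hu hy.
have upper2 u y : edom h u -> edom h y ->
    f2 u - lin ip f2 u y <= M2 / 2 * `|u - y| ^+ 2.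
  by move=> hu hy; have /andP[] := curv2 u y hu hy.
have L1_ge0 : 0 <= L1 by rewrite le_max normr_ge0.
have L2_ge0 : 0 <= L2 by rewrite le_max normr_ge0.
have phiE u : edom h u -> phi u = (objective f1 f2 h u)%:E.
  by move=> hu; rewrite /phi -(Conv_bar_fineK hC hu) -EFinD.
have phi_star_lb u : (phi_star <= phi u)%E by apply: ereal_inf_lbound; exists u.
have phi_star_fin : phi_star = (fine phi_star)%:E.
  rewrite fineK// fin_numE -ltNye phi_star_gt/= lt_eqF//.
  by rewrite (le_lt_trans (phi_star_lb y0))// phiE// ltry.
have phi_star_le u : edom h u -> fine phi_star <= objective f1 f2 h u.
  by move=> hu; rewrite -lee_fin -phi_star_fin -phiE.
have [K [res [Kres KE]]] : exists K res,
    iaicg_halts ip f1 f2 h M2 lambda theta rho y0 K res /\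
    (K%:R - 1) * rho ^+ 2 <= 16 * (Num.sqrt lambda * L1 +
      (1 + theta * Cbar) / Num.sqrt lambda) ^+ 2 *
      (objective f1 f2 h y0 - fine phi_star).
  have r0 := exprn_gt0 2 rho0.
  set G := 16 * _ * _.
  (* Any integer above [G / rho^2] serves as the cap on the number of decreases. *)
  have gap : G < (Num.truncn (G / rho ^+ 2)).+1%:R * rho ^+ 2.
    by rewrite -ltr_pdivrMr// truncnS_gt.
  exact: (iaicg_from_bounded ipN fd hC df2 lambda0 theta0 M2p0 upper1 upper2
    lip1 lip2 L1_ge0 L2_ge0 theta1 stepsize phi_star_le rho0 1 hy0 gap).
split.
- exists K, res; split=> //.
  rewrite phiE// phi_star_fin -EFinB -!EFinM lee_fin.
  move: KE; set A := (_ + _) ^+ 2; set g := _ - fine _ => KE.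
  have A0 : 0 <= A by exact: sqr_ge0.
  (* The first iteration is numbered 1, hence [K - 1]; the stray 1 is absorbed by [16 * 1]. *)
  clearbody A g; have KE' : K%:R - 1 <= 16 * (A * (g * rho ^- 2)).
    by rewrite !mulrA ler_pdivlMr ?exprn_gt0.
  by move: KE'; move: (A * _) => *; lra.
- move=> K' yh vh; exact: iaicg_from_Some.
(* The halting run already found cannot have ended in failure. *)
- move=> f2_convex input.
  move: res Kres KE => [[yh vh]|] Kres _; first by exists K, yh, vh.
  case: (iaicg_from_not_None ipN fd hC df2 lambda0 M2p0 f2_convex _ hy0 Kres)
    => //.
  by move=> y hy u x; have [_ _ _] := input y hy.
Qed.
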